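(* Let $X(\boldsymbol{s})$ be a stationary, mean-square differentiable Gaussian random field on $\mathcal{D}\subset\mathbb{R}^2$ with short-ranged covariance function $c(\boldsymbol{r})$ whose spectral density satisfies $\tilde{C}(\boldsymbol{k})=\mathcal{O}(\|\boldsymbol{k}\|^{-3-\epsilon})$ for some $\epsilon>0$ as $\|\boldsymbol{k}\|\to\infty$. Then, in the asymptotic regime, the probability region of the anisotropy statistics $(\hat R,\hat\theta)$ corresponding to level $p\in[0,1)$ in $(R,\theta)$-space is the region enclosed by the curve given by the parametric equation $$ \left[y^2(\boldsymbol{q};\boldsymbol{Q}^\ast,\boldsymbol{C}_{\hat{\mathbb{Q}}})-\tilde{\lambda}_1(\boldsymbol{Q}^\ast,\boldsymbol{C}_{\hat{\mathbb{Q}}})\right]N=\ln(1-p), $$ where $$ y\sqrt{N}=\frac{-\boldsymbol{Q}^{\ast t}\boldsymbol{C}_{\hat{\mathbb{Q}}}^{-1}\boldsymbol{q}'}{\sqrt{2}\,\big(\boldsymbol{q}'^t\boldsymbol{C}_{\hat{\mathbb{Q}}}^{-1}\boldsymbol{q}'\big)^{1/2}},\qquad 2N\tilde{\lambda}_1=\boldsymbol{Q}^{\ast t}\boldsymbol{C}_{\hat{\mathbb{Q}}}^{-1}\boldsymbol{Q}^\ast,\qquad \boldsymbol{q}'=(1,q_{\mathrm d},q_{\mathrm o})^t, $$ and $\boldsymbol{q}=(q_{\mathrm d},q_{\mathrm o})^t$ is expressed through $(R,\theta)$ by $$ q_{\mathrm d}=\frac{1+R^2\tan^2\theta}{R^2+\tan^2\theta},\qquad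 q_{\mathrm o}=\frac{\tan\theta\,(R^2-1)}{R^2+\tan^2\theta}. $$ That is, the set of $(R,\theta)$ with $[y^2-\tilde\lambda_1]N\ge\ln(1-p)$ contains $(\hat R,\hat\theta)$ with asymptotic probability $p$.
   Context: Setting. $X(\boldsymbol{s})$ is a wide-sense stationary Gaussian random field on $\mathcal D\subset\mathbb{R}^2$ with constant mean, covariance function $c(\boldsymbol{r})$, first-order differentiable in the mean-square sense. Short-ranged means $\int d\boldsymbol{r}\,|c(\boldsymbol{r})|<\infty$; $\tilde{C}$ is the Fourier transform of $c$, and the decay condition means $\tilde C(\boldsymbol{k})\le C_\infty/\|\boldsymbol{k}\|^{3+\epsilon}$ for some $\epsilon,C_\infty>0$ and all large $\|\boldsymbol{k}\|$. $X_{ij}(\boldsymbol{s})=\partial_iX(\boldsymbol{s})\,\partial_jX(\boldsymbol{s})$, $Q^\ast_{ij}=\mathbb{E}[X_{ij}(\boldsymbol{s})]$, $\boldsymbol{Q}^\ast=(Q^\ast_{11},Q^\ast_{22},Q^\ast_{12})^t$. For sampling locations $\boldsymbol{s}_1,\dots,\boldsymbol{s}_N$, $\hat{Q}_{ij}=\frac1N\sum_{k=1}^N X_{ij}(\boldsymbol{s}_k)$, $\hat{\mathbb{Q}}=(\hat{Q}_{11},\hat{Q}_{22},\hat{Q}_{12})^t$, and $\boldsymbol{C}_{\hat{\mathbb{Q}}}$ is the covariance matrix of $\hat{\mathbb{Q}}$, assumed positive definite and of order $\mathcal{O}(1/N)$. The anisotropy statistics $(\hat R,\hat\theta)\in[0,\infty)\times[-\pi/4,\pi/4)$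 solve $\hat Q_{22}/\hat Q_{11}=\frac{1+\hat R^2\tan^2\hat\theta}{\hat R^2+\tan^2\hat\theta}$, $\hat Q_{12}/\hat Q_{11}=\frac{\tan\hat\theta(\hat R^2-1)}{\hat R^2+\tan^2\hat\theta}$. The asymptotic regime is $N\to\infty$ and $|\mathcal D|\to\infty$ with both ratios of domain length to correlation length tending to infinity, so that the Central Limit Theorem applies: the law of $\hat{\mathbb{Q}}$ is taken to be the trivariate Gaussian with mean $\boldsymbol{Q}^\ast$ and covariance $\boldsymbol{C}_{\hat{\mathbb{Q}}}$, and ''asymptotic probability $p$'' means that the probability computed from this Gaussian law tends to $p$ as $N\to\infty$. A probability region at level $p$ is a set in the space of the statistics which contains a proportion $p$ of the values of the statistics, given the true parameters. *)

(* Defs.v *)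
From HB Require Import structures.
From mathcomp Require Import all_boot all_order all_algebra.
From mathcomp Require Import complex.
From mathcomp Require Import all_classical all_reals all_analysis.

Set Implicit Arguments.
Unset Strict Implicit.
Unset Printing Implicit Defensive.

Import Order.TTheory GRing.Theory Num.Theory.
Import numFieldNormedType.Exports.

Local Open Scope classical_set_scope.
Local Open Scope ring_scope.

Section Plane.
Context {R : realType}.
Implicit Types (s r k : R * R) (D : set (R * R)).

Definition coord (i : 'I_2) s : R := if i == 0 then s.1 else s.2.

Definition shift (i : 'I_2) (h : R) s : R * R :=
  if i == 0 then (s.1 + h, s.2) else (s.1, s.2 + h).

Definition dot2 k r : R := k.1 * r.1 + k.2 * r.2.

(* Euclidean norm; `|k| is the sup norm on R * R. *)
Definition norm2 k : R := Num.sqrt (dot2 k k).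

Definition lebesgue2 :
    {measure set (measurableTypeR R * measurableTypeR R) -> \bar R} :=
  (lebesgue_measure \x lebesgue_measure)%E.

Definition lebesgue3 :
    {measure set (measurableTypeR R * measurableTypeR R * measurableTypeR R)
       -> \bar R} :=
  (lebesgue2 \x lebesgue_measure)%E.

(* The length of D in the i-th coordinate direction; for a rectangle with
   sides parallel to the axes, this is the length of a side. *)
Definition extent (i : 'I_2) D : \bar R :=
  ereal_sup
    [set z | exists s s', [/\ D s, D s' & z = (coord i s - coord i s')%:E]].

(* \int c(r) exp(-i k.r) dr *)
Definition fourier (c : R * R -> R) k : R[i] :=
  Complex (\int[lebesgue2]_r (c r * cos (dot2 k r)))
          (- \int[lebesgue2]_r (c r * sin (dot2 k r))).

Definition short_ranged (c : R * R -> R) : Prop :=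
  lebesgue2.-integrable setT (EFin \o c).

Definition spectral_decay (c : R * R -> R) : Prop :=
  exists eps Cinf K : R, [/\ 0 < eps, 0 < Cinf & forall k, K <= norm2 k ->
    ComplexField.Normc.normc (fourier c k) <= Cinf / norm2 k `^ (3 + eps)].

End Plane.

Section Field.
Context {d : measure_display} {T : measurableType d} {R : realType}.
Variable P : probability T R.
Implicit Types (D : set (R * R)) (X : R * R -> {RV P >-> R}).

(* normal_prob m 0 is not a point mass in the library, hence the case
   distinction; linear combinations of field values can be degenerate. *)
Definition normal_law (m sigma : R) (A : set R) : \bar R :=
  if sigma == 0 then \d_m A else normal_prob m sigma A.

Definition gaussian (Y : T -> R) : Prop :=
  exists m sigma : R, forall A : set R, measurable A ->
    P (Y @^-1` A) = normal_law m sigma A.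

Definition gaussian_field D X : Prop :=
  forall (n : nat) (a : 'I_n -> R) (s : 'I_n -> R * R),
    (forall k, D (s k)) -> gaussian (fun w => \sum_(k < n) a k * X (s k) w).

Definition wide_sense_stationary D X (m : R) (c : R * R -> R) : Prop :=
  (forall s, D s -> 'E_P[X s] = m%:E)%E /\
  (forall s s', D s -> D s' -> covariance P (X s) (X s') = (c (s - s'))%:E).

(* dX i s is the mean-square partial derivative of X at s in direction i. The
   increments stay in D, so that it is one-sided at boundary points. *)
Definition ms_derivative D X (dX : 'I_2 -> R * R -> {RV P >-> R}) : Prop :=
  forall (i : 'I_2) s, D s ->
    ('E_P[(fun w => ((X (shift i h s) w - X s w) / h - dX i s w) ^+ 2)%R])%E
      @[h --> within [set h : R | h != 0 /\ D (shift i h s)] (nbhs (0 : R))]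
    --> 0%E.

(* Triples are ordered as in (Q_11, Q_22, Q_12). *)
Definition pair_of (a : 'I_3) : 'I_2 * 'I_2 :=
  nth (0, 0) [:: (0, 0); (1, 1); (0, 1)] a.

Definition Xprod (dX : 'I_2 -> R * R -> {RV P >-> R}) (a : 'I_3) (s : R * R)
    (w : T) : R :=
  dX (pair_of a).1 s w * dX (pair_of a).2 s w.

Definition Qhat (dX : 'I_2 -> R * R -> {RV P >-> R}) (N : nat)
    (s : 'I_N -> R * R) (a : 'I_3) (w : T) : R :=
  N%:R^-1 * \sum_(k < N) Xprod dX a (s k) w.

Definition is_covariance_matrix n (Y : 'I_n -> T -> R) (C : 'M[R]_n) : Prop :=
  forall a b, covariance P (Y a) (Y b) = (C a b)%:E.

End Field.

Section Statistics.
Context {R : realType}.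
Implicit Types (C : 'M[R]_3) (Q : 'cV[R]_3) (x : R * R * R) (rt : R * R).

Definition qform C (u v : 'cV[R]_3) : R := (u^T *m C *m v) 0 0.

Definition positive_definite C : Prop :=
  forall v : 'cV[R]_3, v != 0 -> 0 < qform C v v.

Definition col3 x : 'cV[R]_3 := \col_i [:: x.1.1; x.1.2; x.2]`_i.

(* For C symmetric positive definite. *)
Definition gauss3_pdf Q C x : R :=
  expR (- qform (invmx C) (col3 x - Q) (col3 x - Q) / 2)
  / Num.sqrt ((2 * pi) ^+ 3 * \det C).

Definition gauss3 Q C (A : set (R * R * R)) : \bar R :=
  (\int[lebesgue3]_(x in A) (gauss3_pdf Q C x)%:E)%E.

Definition denom rt : R := rt.1 ^+ 2 + tan rt.2 ^+ 2.

Definition q_d rt : R := (1 + rt.1 ^+ 2 * tan rt.2 ^+ 2) / denom rt.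

Definition q_o rt : R := tan rt.2 * (rt.1 ^+ 2 - 1) / denom rt.

(* [0, +oo) x [-pi/4, pi/4), without the point (0, 0), at which q_d and q_o
   are undefined. *)
Definition Rtheta : set (R * R) :=
  [set rt | [/\ 0 <= rt.1, - pi / 4 <= rt.2, rt.2 < pi / 4 & denom rt != 0]].

(* x = (Q_11, Q_22, Q_12) *)
Definition solves x rt : Prop :=
  [/\ Rtheta rt, x.1.1 != 0, x.1.2 / x.1.1 = q_d rt & x.2 / x.1.1 = q_o rt].

(* The system has several solutions for isotropic x (where R = 1 and theta is
   arbitrary) and none for indefinite x, so the statistics are any random
   variable which solves it where it is solvable. *)
Definition anisotropy_statistics (st : R * R * R -> R * R) : Prop :=
  measurable_fun setT st /\
  (forall x, (exists rt, solves x rt) -> solves x (st x)).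

Definition qprime rt : 'cV[R]_3 := col3 (1, q_d rt, q_o rt).

Definition y_stat (N : nat) Q C rt : R :=
  - qform (invmx C) Q (qprime rt)
  / (Num.sqrt 2 * Num.sqrt (qform (invmx C) (qprime rt) (qprime rt)))
  / Num.sqrt N%:R.

Definition lambda1 (N : nat) Q C : R := qform (invmx C) Q Q / (2 * N%:R).

Definition level_fun (N : nat) Q C rt : R :=
  (y_stat N Q C rt ^+ 2 - lambda1 N Q C) * N%:R.

(* The region enclosed by the curve level_fun N Q C rt = ln (1 - p). *)
Definition region (p : R) (N : nat) Q C : set (R * R) :=
  [set rt | Rtheta rt /\ ln (1 - p) <= level_fun N Q C rt].

End Statistics.

(* Main.v *)
Require Import Defs.
From HB Require Import structures.
From mathcomp Require Import all_boot all_order all_algebra.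
From mathcomp Require Import ring lra.
From mathcomp Require Import all_classical all_reals all_analysis measurable_realfun.

(** Fix a sample size, and write Q for the mean, C for the covariance matrix and
    M = C^-1; lengths and angles below are those of the inner product of M.

    The statistics only see the direction of x = (Q_11, Q_22, Q_12): where the
    system is solvable, x = x_11 q', and the left-hand side of the equation of
    the curve is homogeneous of degree 0 in q'. It equals minus half the squared
    distance from Q to the line spanned by x ([level_fun_profile]). The region is
    therefore the set of directions whose line passes within squared distance
    L = - 2 ln (1 - p) of Q.

    Since C = O(1/N), the length n of Q tends to infinity, whereas x - Q is
    standard normal for M. Seen from the origin, x lies at a small angle from Q,
    so the distance from Q to the line of x is asymptotically the distance from x
    to the line of Q. Its square follows the chi-squared law with two degrees of
    freedom, and P (chi_2^2 <= L) = 1 - exp (- L / 2) = p.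

    To turn this into a limit of integrals, x is written as an affine image
    [unwhiten] z of a standard normal z, whose first coordinate is taken along Q
    ([gauss3_unwhiten]). With r^2 = z_2^2 + z_3^2, the event becomes
    n^2 r^2 <= L ((n + z_1)^2 + r^2) ([unwhiten_near_mean]), which for fixed z
    agrees with r^2 <= L for all large n, unless r^2 = L. Dominated convergence
    for the fixed standard normal law then gives the limit ([cvg_std_gauss3]).

    Two points remain. The system is solvable when x, read as a symmetric matrix,
    is positive definite ([solvable_on_cone]); elsewhere the statistics may be
    arbitrary, and the event is squeezed between its intersection
    with this cone and its union with the complement. Both bounds have the limit
    p because x tends to Q and Q lies in the open cone. The latter holds because
    otherwise some directional derivative of the field would vanish almost surely,
    a linear relation between the three products of derivatives which contradicts
    the positive definiteness of C ([gradient_cone]). *)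

Set Implicit Arguments.
Unset Strict Implicit.
Unset Printing Implicit Defensive.

Import Order.TTheory GRing.Theory Num.Theory.
Import numFieldNormedType.Exports.

Local Open Scope classical_set_scope.
Local Open Scope ring_scope.

(** * Affine changes of variables *)

Section Affine.
Context {R : realType}.
Local Notation mu := (@lebesgue_measure R).
Implicit Types (a b : R) (f : R -> \bar R).

Lemma measurable_affine a b : measurable_fun setT (fun y : R => a * y + b).
Proof. by apply: measurable_funD => //; exact: measurable_funM. Qed.

Lemma lebesgue_measure_preimage_affine a b (A : set R) : a != 0 ->
  measurable A -> mu A = (`|a|%:E * mu ((fun y => (a * y + b)%R) @^-1` A))%E.
Proof.
move=> a0 mA.
pose phi (y : measurableTypeR R) : measurableTypeR R := a * y + b.
have mphi : measurable_fun setT phi := measurable_affine a b.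
pose m' := mscale (NngNum (normr_ge0 a)) (pushforward mu phi).
rewrite [LHS](@lebesgue_measure_unique _ (m' mphi)) // => _ [[c d]] _ <- /=.
rewrite /m' /mscale /= /pushforward.
have [ap|an|/eqP] := ltgtP a 0; last by rewrite (negbTE a0).
- rewrite (_ : _ @^-1` _ = `[(d - b) / a, (c - b) / a[%classic); last first.
    apply/seteqP; split => y; rewrite /phi /= !in_itv /=.
      by rewrite ler_ndivrMr // ltr_ndivlMr // => /andP[? ?]; apply/andP; split; lra.
    by rewrite ler_ndivrMr // ltr_ndivlMr // => /andP[? ?]; apply/andP; split; lra.
  rewrite !lebesgue_measure_itv /= !lte_fin ltr_ndivrMr // divfK ?lt_eqF // ltrD2r.
  case: ifPn => _; last by rewrite mule0.
  rewrite -!EFinB -EFinM ltr0_norm //; congr EFin.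
  by rewrite -mulrBl mulrCA mulNr divff //; lra.
- rewrite (_ : _ @^-1` _ = `](c - b) / a, (d - b) / a]%classic); last first.
    apply/seteqP; split => y; rewrite /phi /= !in_itv /=.
      by rewrite ltr_pdivrMr // ler_pdivlMr // => /andP[? ?]; apply/andP; split; lra.
    by rewrite ltr_pdivrMr // ler_pdivlMr // => /andP[? ?]; apply/andP; split; lra.
  rewrite !lebesgue_measure_itv /= !lte_fin ltr_pdivrMr // divfK ?gt_eqF // ltrD2r.
  case: ifPn => _; last by rewrite mule0.
  rewrite -!EFinB -EFinM gtr0_norm //; congr EFin.
  by rewrite -mulrBl mulrCA divff //; lra.
Qed.

Lemma ge0_integral_affine a b f : a != 0 ->
  measurable_fun setT f -> (forall y, 0 <= f y)%E ->
  (\int[mu]_y f y = `|a|%:E * \int[mu]_y f (a * y + b)%R)%E.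
Proof.
move=> a0 mf f0.
pose phi (y : measurableTypeR R) : measurableTypeR R := a * y + b.
have mphi : measurable_fun setT phi := measurable_affine a b.
pose m' := mscale (NngNum (normr_ge0 a)) (pushforward mu phi).
transitivity (\int[m' mphi]_y f y)%E.
  apply: eq_measure_integral => A mA _.
  exact: lebesgue_measure_preimage_affine.
rewrite ge0_integral_mscale //=; congr (_ * _)%E.
by rewrite ge0_integral_pushforward.
Qed.

End Affine.

(** * Shears of the plane and of space *)

Section Shears.
Context {R : realType}.
Local Notation mu := (@lebesgue_measure R).
Local Notation T1 := (measurableTypeR R).
Implicit Types (a : R) (F : T1 * T1 * T1 -> \bar R) (g : T1 * T1 -> T1).
Local Open Scope ereal_scope.

Lemma sigma_finite_lebesgue2 : sigma_finite setT (@lebesgue2 R).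
Proof.
have /sigma_finiteP[A [AT ndA Aoo]] := sigma_finiteT mu.
exists (fun n => A n `*` A n).
  rewrite -setXTT AT predeqE => -[x y]; split; last by move=> [n _ []]; split; exists n.
  move=> [/= [n _ Anx] [k _ Aky]]; exists (maxn n k) => //; split.
    by move: x Anx; exact/subsetPset/ndA/leq_maxl.
  by move: y Aky; exact/subsetPset/ndA/leq_maxr.
move=> k; have [mA Ak] := Aoo k; split; first exact: measurableX.
by rewrite /lebesgue2 /= product_measure1E // lte_mul_pinfty // ge0_fin_numE.
Qed.

(** The product measure packed with its sigma-finiteness, which Tonelli's theorem
    needs when the plane is itself a factor. *)
Let leb2 : {sigma_finite_measure set (T1 * T1)%type -> \bar R}%R :=
  HB.pack (lebesgue2 : set (T1 * T1)%type -> \bar R)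
    (Measure.class (@lebesgue2 R))
    (Measure_isSigmaFinite.Build _ _ _ (@lebesgue2 R) sigma_finite_lebesgue2).

Lemma integral_lebesgue3_3 F : measurable_fun setT F -> (forall x, 0 <= F x) ->
  \int[lebesgue3]_x F x = \int[lebesgue2]_q \int[mu]_z F (q, z).
Proof. exact: (fubini_tonelli1 (m1 := leb2) (m2 := mu)). Qed.

Lemma integral_lebesgue3_12 F : measurable_fun setT F -> (forall x, 0 <= F x) ->
  \int[lebesgue3]_x F x = \int[mu]_z \int[lebesgue2]_q F (q, z).
Proof. exact: (fubini_tonelli2 (m1 := leb2) (m2 := mu)). Qed.

Lemma integral_lebesgue2_1 (G : T1 * T1 -> \bar R) :
  measurable_fun setT G -> (forall x, 0 <= G x) ->
  \int[lebesgue2]_x G x = \int[mu]_y \int[mu]_x G (x, y).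
Proof. exact: (fubini_tonelli2 (m1 := mu) (m2 := mu)). Qed.

Lemma integral_lebesgue2_2 (G : T1 * T1 -> \bar R) :
  measurable_fun setT G -> (forall x, 0 <= G x) ->
  \int[lebesgue2]_x G x = \int[mu]_x \int[mu]_y G (x, y).
Proof. exact: (fubini_tonelli1 (m1 := mu) (m2 := mu)). Qed.

(** The coordinate that moves is integrated innermost, where the change of
    variables is affine with the other two coordinates fixed. The function [g] is
    arbitrary, hence every triangular linear map is a composite of such shears. *)
Lemma ge0_integral_shear3 a g F : a != 0%R -> measurable_fun setT g ->
  measurable_fun setT F -> (forall x, 0 <= F x) ->
  \int[lebesgue3]_x F x =
  `|a|%:E * \int[lebesgue3]_x F (x.1, (a * x.2 + g x.1)%R).
Proof.
move=> a0 mg mF F0.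
have mFg : measurable_fun setT
    (fun x : T1 * T1 * T1 => F (x.1, (a * x.2 + g x.1)%R)).
  apply: measurableT_comp => //; apply: measurable_fun_pair => //=.
  apply: measurable_funD; first exact: measurable_funM.
  exact: measurableT_comp.
rewrite !integral_lebesgue3_3 //= -ge0_integralZl //=; last 2 first.
- exact: (measurable_fun_fubini_tonelli_F _ mFg).
- by move=> q _; exact: integral_ge0.
apply: eq_integral => q _; rewrite (@ge0_integral_affine _ a (g q)) //.
exact: measurableT_comp.
Qed.

Lemma ge0_integral_shear12 a (G : T1 * T1 -> \bar R) (h : T1 -> T1) : a != 0%R ->
  measurable_fun setT h -> measurable_fun setT G -> (forall x, 0 <= G x) ->
  \int[lebesgue2]_x G x = `|a|%:E * \int[lebesgue2]_x G ((a * x.1 + h x.2)%R, x.2).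
Proof.
move=> a0 mh mG G0.
have mGh : measurable_fun setT
    (fun x : T1 * T1 => G ((a * x.1 + h x.2)%R, x.2)).
  apply: measurableT_comp => //; apply: measurable_fun_pair => //=.
  apply: measurable_funD; first exact: measurable_funM.
  exact: measurableT_comp.
rewrite !integral_lebesgue2_1 //= -ge0_integralZl //=; last 2 first.
- exact: (measurable_fun_fubini_tonelli_G _ mGh).
- by move=> q _; exact: integral_ge0.
apply: eq_integral => q _; rewrite (@ge0_integral_affine _ a (h q)) //.
exact: measurableT_comp.
Qed.

Lemma ge0_integral_shear22 a (G : T1 * T1 -> \bar R) (h : T1 -> T1) : a != 0%R ->
  measurable_fun setT h -> measurable_fun setT G -> (forall x, 0 <= G x) ->
  \int[lebesgue2]_x G x = `|a|%:E * \int[lebesgue2]_x G (x.1, (a * x.2 + h x.1)%R).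
Proof.
move=> a0 mh mG G0.
have mGh : measurable_fun setT
    (fun x : T1 * T1 => G (x.1, (a * x.2 + h x.1)%R)).
  apply: measurableT_comp => //; apply: measurable_fun_pair => //=.
  apply: measurable_funD; first exact: measurable_funM.
  exact: measurableT_comp.
rewrite !integral_lebesgue2_2 //= -ge0_integralZl //=; last 2 first.
- exact: (measurable_fun_fubini_tonelli_F _ mGh).
- by move=> q _; exact: integral_ge0.
apply: eq_integral => q _; rewrite (@ge0_integral_affine _ a (h q)) //.
exact: measurableT_comp.
Qed.

Lemma ge0_integral_shear1 a g F : a != 0%R -> measurable_fun setT g ->
  measurable_fun setT F -> (forall x, 0 <= F x) ->
  \int[lebesgue3]_x F x =
  `|a|%:E * \int[lebesgue3]_x F ((a * x.1.1 + g (x.1.2, x.2))%R, x.1.2, x.2).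
Proof.
move=> a0 mg mF F0.
have mFg : measurable_fun setT (fun x : T1 * T1 * T1 =>
    F ((a * x.1.1 + g (x.1.2, x.2))%R, x.1.2, x.2)).
  apply: measurableT_comp => //; apply: measurable_fun_pair => //=.
  apply: measurable_fun_pair; last exact: measurableT_comp.
  apply: measurable_funD; first by apply: measurable_funM => //; exact: measurableT_comp.
  apply: measurableT_comp => //; apply: measurable_fun_pair => //=.
  exact: measurableT_comp.
rewrite !integral_lebesgue3_12 //= -ge0_integralZl //=; last 2 first.
- exact: (measurable_fun_fubini_tonelli_G (m1 := leb2) _ mFg).
- by move=> q _; exact: integral_ge0.
apply: eq_integral => q _.
rewrite (@ge0_integral_shear12 a _ (fun y => g (y, q))) //.
- by apply: measurableT_comp => //; exact: measurable_fun_pair.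
- by apply: measurableT_comp => //; exact: measurable_fun_pair.
Qed.

Lemma ge0_integral_shear2 a g F : a != 0%R -> measurable_fun setT g ->
  measurable_fun setT F -> (forall x, 0 <= F x) ->
  \int[lebesgue3]_x F x =
  `|a|%:E * \int[lebesgue3]_x F (x.1.1, (a * x.1.2 + g (x.1.1, x.2))%R, x.2).
Proof.
move=> a0 mg mF F0.
have mFg : measurable_fun setT (fun x : T1 * T1 * T1 =>
    F (x.1.1, (a * x.1.2 + g (x.1.1, x.2))%R, x.2)).
  apply: measurableT_comp => //; apply: measurable_fun_pair => //=.
  apply: measurable_fun_pair; first exact: measurableT_comp.
  apply: measurable_funD; first by apply: measurable_funM => //; exact: measurableT_comp.
  apply: measurableT_comp => //; apply: measurable_fun_pair => //=.
  exact: measurableT_comp.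
rewrite !integral_lebesgue3_12 //= -ge0_integralZl //=; last 2 first.
- exact: (measurable_fun_fubini_tonelli_G (m1 := leb2) _ mFg).
- by move=> q _; exact: integral_ge0.
apply: eq_integral => q _.
rewrite (@ge0_integral_shear22 a _ (fun y => g (y, q))) //.
- by apply: measurableT_comp => //; exact: measurable_fun_pair.
- by apply: measurableT_comp => //; exact: measurable_fun_pair.
Qed.

End Shears.

(** * Quadratic forms on R^3 *)

Section QuadraticForm.
Context {R : realType}.
Implicit Types (C M : 'M[R]_3) (u v w : 'cV[R]_3).

Lemma qformDl M u v w : qform M (u + v) w = qform M u w + qform M v w.
Proof. by rewrite /qform linearD !mulmxDl mxE. Qed.

Lemma qformDr M u v w : qform M u (v + w) = qform M u v + qform M u w.
Proof. by rewrite /qform mulmxDr mxE. Qed.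

Lemma qformZl M a u v : qform M (a *: u) v = a * qform M u v.
Proof. by rewrite /qform linearZ /= -!scalemxAl mxE. Qed.

Lemma qformZr M a u v : qform M u (a *: v) = a * qform M u v.
Proof. by rewrite /qform -!scalemxAr mxE. Qed.

Lemma qformC M u v : M^T = M -> qform M u v = qform M v u.
Proof.
move=> Ms; rewrite /qform.
have -> : (u^T *m M *m v) 0 0 = ((u^T *m M *m v)^T) 0 0 by rewrite [RHS]mxE.
by rewrite !trmx_mul trmxK Ms mulmxA.
Qed.

Lemma positive_definite_unitmx C : positive_definite C -> C \in unitmx.
Proof.
move=> Cpos; rewrite unitmxE unitfE; apply/det0P => -[v v0 vC].
have vT0 : v^T != 0 by rewrite -(trmx0 R 1 3) (can_eq (@trmxK _ _ _)).
by have := Cpos _ vT0; rewrite /qform trmxK vC mul0mx mxE ltxx.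
Qed.

Lemma positive_definite_invmx C :
  C^T = C -> positive_definite C -> positive_definite (invmx C).
Proof.
move=> Cs Cpos v v0; have Cu := positive_definite_unitmx Cpos.
have w0 : invmx C *m v != 0.
  by apply: contra v0 => /eqP w0; rewrite -(mulKVmx Cu v) w0 mulmx0.
have := Cpos _ w0; rewrite /qform trmx_mul trmx_inv Cs.
by rewrite -!mulmxA (mulKVmx Cu).
Qed.

(** Cauchy-Schwarz for the form of C^-1, applied to v and C e_i: the product of
    these two vectors is the i-th coordinate of v, and the square of the second
    is C_ii. The proof expands the square of v - s C e_i. *)
Lemma coord_le_qform_invmx C v i : C^T = C -> positive_definite C ->
  v i 0 ^+ 2 <= C i i * qform (invmx C) v v.
Proof.
move=> Cs Cpos; have Cu := positive_definite_unitmx Cpos.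
have Ms : (invmx C)^T = invmx C by rewrite trmx_inv Cs.
pose e : 'cV[R]_3 := delta_mx i 0.
have Cii : qform C e e = C i i.
  by rewrite /qform /e trmx_delta -rowE -colE !mxE.
have Ci0 : 0 < C i i.
  by rewrite -Cii; apply: Cpos; apply/negP => /eqP /matrixP /(_ i 0);
     rewrite !mxE !eqxx => /eqP; rewrite oner_eq0.
have eM w : qform (invmx C) (C *m e) w = w i 0.
  by rewrite /qform trmx_mul Cs mulmxK // /e trmx_delta -rowE mxE.
(* the value of s which minimises this square *)
pose s := v i 0 / C i i.
have : 0 <= qform (invmx C) (v + (- s) *: (C *m e)) (v + (- s) *: (C *m e)).
  have [->|w0] := eqVneq (v + (- s) *: (C *m e)) 0.
    by rewrite /qform mulmx0 mxE.
  exact/ltW/positive_definite_invmx.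
rewrite !(qformDl, qformDr, qformZl, qformZr) eM eM (qformC _ _ Ms) eM.
rewrite (_ : (C *m e) i 0 = C i i); last by rewrite /e -colE mxE.
set q := qform _ v v; rewrite /s => h.
rewrite -subr_ge0; apply: le_trans (mulr_ge0 (ltW Ci0) h) _.
by rewrite le_eqVlt; apply/orP; left; apply/eqP; field; rewrite gt_eqF.
Qed.

End QuadraticForm.

Lemma det_mx33 (R : comRingType) (A : 'M[R]_3) : \det A =
  A 0 0 * (A 1 1 * A 2 2 - A 1 2 * A 2 1)
  - A 0 1 * (A 1 0 * A 2 2 - A 1 2 * A 2 0)
  + A 0 2 * (A 1 0 * A 2 1 - A 1 1 * A 2 0).
Proof.
pose B (i j : nat) := A (inord i) (inord j).
have AB i j : A i j = B i j by rewrite /B !inord_val.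
rewrite (expand_det_row _ 0) !big_ord_recl big_ord0 /cofactor.
rewrite !(expand_det_row _ 0) !big_ord_recl !big_ord0 /cofactor !det_mx11 !mxE /=.
rewrite !AB /= /bump /= ?(addn0, addn1, add0n, add1n) /=.
by ring.
Qed.

(** * Measurability of polynomial maps *)

Section Coordinates.
Context {R : realType}.
Local Notation T1 := (measurableTypeR R).

Lemma measurable_coord1 : measurable_fun setT (fun z : T1 * T1 * T1 => z.1.1 : T1).
Proof. exact: measurableT_comp. Qed.

Lemma measurable_coord2 : measurable_fun setT (fun z : T1 * T1 * T1 => z.1.2 : T1).
Proof. exact: measurableT_comp. Qed.

Lemma measurable_coord3 : measurable_fun setT (fun z : T1 * T1 * T1 => z.2 : T1).
Proof. exact: measurable_snd. Qed.

Lemma measurable_col3 i : measurable_fun setT ((fun x => col3 x i 0) : T1 * T1 * T1 -> T1).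
Proof.
under eq_fun do rewrite !mxE.
by case: i => [[|[|[|//]]]] /= _;
  [exact: measurable_coord1 | exact: measurable_coord2 | exact: measurable_coord3].
Qed.

Lemma measurable_qform d (T : measurableType d) (M : 'M[R]_3) (f g : T -> 'cV[R]_3) :
  (forall i, measurable_fun setT (fun x => f x i 0)) ->
  (forall i, measurable_fun setT (fun x => g x i 0)) ->
  measurable_fun setT (fun x => qform M (f x) (g x)).
Proof.
move=> mf mg; rewrite /qform; under eq_fun do rewrite mxE.
apply: measurable_sum => i; apply: measurable_funM; last exact: mg.
under eq_fun do rewrite mxE.
apply: measurable_sum => j; apply: measurable_funM => //.
by under eq_fun do rewrite mxE; exact: mf.
Qed.

End Coordinates.

(** Constants come last, since their pattern matches any function. *)
Ltac measurable_poly := cbv zeta; cbn beta; repeat (cbn beta; lazymatch goal with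
  | |- measurable_fun _ (fun z => z.1.1) => exact: measurable_coord1
  | |- measurable_fun _ (fun z => z.1.2) => exact: measurable_coord2
  | |- measurable_fun _ (fun z => z.1) => exact: measurable_fst
  | |- measurable_fun _ (fun z => z.2) => exact: measurable_snd
  | |- measurable_fun _ fst => exact: measurable_fst
  | |- measurable_fun _ snd => exact: measurable_snd
  | |- measurable_fun _ (fun z => z) => exact: measurable_id
  | |- measurable_fun _ (fun z => _ + _) => apply: measurable_funD
  | |- measurable_fun _ (fun z => - _) => apply: measurable_funN
  | |- measurable_fun _ (fun z => _ * _) => apply: measurable_funM
  | |- measurable_fun _ (fun z => _ ^+ _) => apply: measurable_funX
  | |- measurable_fun _ (fun z => (_, _)) => apply: measurable_fun_pair
  | |- measurable_fun _ _ => exact: measurable_cst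
  end).

(** * Standardization along the direction of the mean *)

Section Standardization.
Context {R : realType}.
Local Notation T1 := (measurableTypeR R).
Variables (C : 'M[R]_3) (Q : 'cV[R]_3).
Hypotheses (Csym : C^T = C) (Cpos : positive_definite C) (Q0 : 0 < Q 0 0).

Let M := invmx C.
Let u2 : 'cV[R]_3 := col3 (0, 1, 0).
Let u3 : 'cV[R]_3 := col3 (0, 0, 1).

(** In the basis (Q, u2, u3), the square of t Q + U u2 + V u3 is completed first in
    t, then in V:
      n^2 (t + (b U + c V) / n^2)^2 + e3^2 (V + rho U)^2 + e2^2 U^2.
    Taking Q as the first basis vector makes the first square the component along
    Q, up to the factor n. *)
Let b := qform M Q u2.
Let c := qform M Q u3.
Let n := Num.sqrt (qform M Q Q).
Let e3 := Num.sqrt (qform M u3 u3 - c ^+ 2 / n ^+ 2).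
Let rho := (qform M u2 u3 - b * c / n ^+ 2) / e3 ^+ 2.
Let e2 := Num.sqrt (qform M u2 u2 - b ^+ 2 / n ^+ 2 - rho ^+ 2 * e3 ^+ 2).

Let Mpos : positive_definite M. Proof. exact: positive_definite_invmx. Qed.

Let Msym : M^T = M. Proof. by rewrite /M trmx_inv Csym. Qed.

Let Qu (x y z : R) : x *: Q + y *: u2 + z *: u3 =
  col3 (x * Q 0 0, x * Q 1 0 + y, x * Q 2 0 + z).
Proof.
apply/colP => i; rewrite !mxE /=.
case: i => [[|[|[|//]]]] /= ?; rewrite ?mulr0 ?mulr1 ?addr0 //;
  do ?congr (_ + _); congr (x * Q _ _); exact: val_inj.
Qed.

Let qf (x y z : R) : qform M (x *: Q + y *: u2 + z *: u3) (x *: Q + y *: u2 + z *: u3) =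
  x ^+ 2 * qform M Q Q + y ^+ 2 * qform M u2 u2 + z ^+ 2 * qform M u3 u3
  + 2 * (x * y * b + x * z * c + y * z * qform M u2 u3).
Proof.
rewrite !(qformDl, qformDr, qformZl, qformZr) (qformC u2 Q) // (qformC u3 Q) //.
by rewrite (qformC u3 u2) // -/b -/c; ring.
Qed.

Let qf_gt0 (x y z : R) : (x != 0) || (y != 0) || (z != 0) ->
  0 < qform M (x *: Q + y *: u2 + z *: u3) (x *: Q + y *: u2 + z *: u3).
Proof.
move=> xyz; apply: Mpos; apply: contraL xyz => /eqP; rewrite Qu => /colP v0.
have := v0 0; have := v0 1; have := v0 2; rewrite !mxE /=.
move=> z0 y0 /eqP; rewrite mulf_eq0 (gt_eqF Q0) orbF => /eqP x0.
by move: y0 z0; rewrite x0 !mul0r !add0r => -> ->; rewrite eqxx.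
Qed.

Let n_gt0 : 0 < n.
Proof.
by rewrite sqrtr_gt0; have := @qf_gt0 1 0 0; rewrite !scale0r !addr0 scale1r oner_eq0; exact.
Qed.

Let n2 : qform M Q Q = n ^+ 2.
Proof. by rewrite sqr_sqrtr // ltW // -sqrtr_gt0. Qed.

Let e3_gt0 : 0 < e3.
Proof.
rewrite sqrtr_gt0; have := @qf_gt0 (- c / n ^+ 2) 0 1; rewrite oner_eq0 orbT => /(_ isT).
rewrite qf n2 => h; apply: lt_le_trans h _.
by rewrite le_eqVlt; apply/orP; left; apply/eqP; field; rewrite gt_eqF.
Qed.

Let f_def : qform M u3 u3 = e3 ^+ 2 + c ^+ 2 / n ^+ 2.
Proof. by rewrite [e3 ^+ 2]sqr_sqrtr ?subrK // ltW // -sqrtr_gt0. Qed.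

Let e_def : qform M u2 u3 = rho * e3 ^+ 2 + b * c / n ^+ 2.
Proof. by rewrite /rho divfK ?subrK // expf_neq0 // gt_eqF. Qed.

Let e2_gt0 : 0 < e2.
Proof.
rewrite sqrtr_gt0.
have := @qf_gt0 (- (b - c * rho) / n ^+ 2) 1 (- rho); rewrite oner_eq0 orbT => /(_ isT).
rewrite qf n2 f_def e_def => h; apply: lt_le_trans h _.
by rewrite le_eqVlt; apply/orP; left; apply/eqP; field; rewrite gt_eqF.
Qed.

Let d_def : qform M u2 u2 = e2 ^+ 2 + b ^+ 2 / n ^+ 2 + rho ^+ 2 * e3 ^+ 2.
Proof. by rewrite [e2 ^+ 2]sqr_sqrtr; [ring | rewrite ltW // -sqrtr_gt0]. Qed.

(** The three completed squares are z_1^2, z_3^2 and z_2^2, solved for U, V and t. *)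
Definition unwhiten (z : R * R * R) : R * R * R :=
  let U := e2^-1 * z.1.2 in
  let V := e3^-1 * z.2 - rho * U in
  let t := n^-1 * z.1.1 - (b * U + c * V) / n ^+ 2 in
  (Q 0 0 * (1 + t), Q 1 0 * (1 + t) + U, Q 2 0 * (1 + t) + V).

Let U (z : R * R * R) := e2^-1 * z.1.2.
Let V (z : R * R * R) := e3^-1 * z.2 - rho * U z.
Let t (z : R * R * R) := n^-1 * z.1.1 - (b * U z + c * V z) / n ^+ 2.

Let col3_unwhiten z : col3 (unwhiten z) = (1 + t z) *: Q + U z *: u2 + V z *: u3.
Proof. by rewrite Qu ![(1 + t z) * _]mulrC. Qed.

Lemma qform_unwhitenB z :
  qform M (col3 (unwhiten z) - Q) (col3 (unwhiten z) - Q) =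
  z.1.1 ^+ 2 + z.1.2 ^+ 2 + z.2 ^+ 2.
Proof.
have -> : col3 (unwhiten z) - Q = t z *: Q + U z *: u2 + V z *: u3.
  by apply/eqP; rewrite subr_eq col3_unwhiten scalerDl scale1r [eqbRHS]addrC !addrA.
rewrite qf n2 f_def e_def d_def /t /V /U.
by field; rewrite !gt_eqF.
Qed.

Lemma qform_unwhiten z :
  qform M (col3 (unwhiten z)) (col3 (unwhiten z)) =
  (n + z.1.1) ^+ 2 + z.1.2 ^+ 2 + z.2 ^+ 2.
Proof.
rewrite col3_unwhiten qf n2 f_def e_def d_def /t /V /U.
by field; rewrite !gt_eqF.
Qed.

Lemma qform_mean_unwhiten z : qform M Q (col3 (unwhiten z)) = n * (n + z.1.1).
Proof.
rewrite col3_unwhiten !(qformDr, qformZr) n2 -/b -/c /t /V /U.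
by field; rewrite !gt_eqF.
Qed.

(** The Gram determinant of (Q, u2, u3) is the product of the coefficients of the
    three squares, and also Q_11^2 det M, as the matrix of this basis is lower
    triangular with diagonal (Q_11, 1, 1). *)
Let det_C : Num.sqrt (\det C) = Q 0 0 / n / e2 / e3.
Proof.
have Cu := positive_definite_unitmx Cpos.
have C0 : \det C != 0 by rewrite -unitfE -unitmxE.
have qE (v w : 'cV[R]_3) : qform M v w =
    \sum_j (\sum_i v i 0 * M i j) * w j 0.
  rewrite /qform !mxE; apply: eq_bigr => j _; rewrite !mxE; congr (_ * _).
  by apply: eq_bigr => i _; rewrite !mxE.
have MC i j : M i j = M j i by rewrite -[in LHS]Msym mxE.
have detM : Q 0 0 ^+ 2 * \det M = n ^+ 2 * e2 ^+ 2 * e3 ^+ 2.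
  have -> : n ^+ 2 * e2 ^+ 2 * e3 ^+ 2 =
      n ^+ 2 * (qform M u2 u2 * qform M u3 u3 - qform M u2 u3 ^+ 2)
      - b * (b * qform M u3 u3 - c * qform M u2 u3)
      + c * (b * qform M u2 u3 - c * qform M u2 u2).
    by rewrite f_def e_def d_def; field; rewrite gt_eqF.
  rewrite -n2 /b /c det_mx33 !qE !big_ord_recl !big_ord0 !mxE /=.
  have -> : lift ord0 (ord0 : 'I_2) = 1 :> 'I_3 by exact: val_inj.
  have -> : lift ord0 (lift ord0 (ord0 : 'I_1)) = 2 :> 'I_3 by exact: val_inj.
  rewrite (MC 1 0) (MC 2 0) (MC 2 1).
  by ring.
have detM' : \det M = (\det C)^-1.
  by apply: (mulIf C0); rewrite mulVf // -det_mulmx mulVmx // det1.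
have -> : \det C = (Q 0 0 / n / e2 / e3) ^+ 2.
  apply: invr_inj; rewrite -detM'; apply: (mulfI (expf_neq0 2 (lt0r_neq0 Q0))).
  by rewrite detM; field; rewrite !gt_eqF.
by rewrite sqrtr_sqr ger0_norm // !divr_ge0 // ltW.
Qed.

Lemma measurable_unwhiten : measurable_fun setT (unwhiten : T1 * T1 * T1 -> T1 * T1 * T1).
Proof. by rewrite /unwhiten; measurable_poly. Qed.

Let g1 (q : T1 * T1) : T1 := (1 - (b * q.1 + c * q.2) / n ^+ 2) * Q 0 0.

(** The matrix of [unwhiten] is the product of a lower and an upper triangular
    matrix, so that five shears suffice: two clear the first column, which is
    proportional to Q, and three perform the triangular substitution. *)
Lemma ge0_integral_unwhiten (F : T1 * T1 * T1 -> \bar R) :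
  measurable_fun setT F -> (forall x, (0 <= F x)%E) ->
  (\int[lebesgue3]_x F x =
   (Num.sqrt (\det C))%:E * \int[lebesgue3]_z F (unwhiten z))%E.
Proof.
move=> mF F0; have Q0' : Q 0 0 != 0 by rewrite gt_eqF.
rewrite (@ge0_integral_shear3 _ 1 (fun q => (Q 2 0 / Q 0 0) * q.1)) ?oner_eq0 //;
  last by measurable_poly.
rewrite (@ge0_integral_shear2 _ 1 (fun q => (Q 1 0 / Q 0 0) * q.1)) ?oner_eq0 //=; last 2 first.
- by measurable_poly.
- by apply: (measurableT_comp mF); measurable_poly.
rewrite (@ge0_integral_shear1 _ (Q 0 0 / n) g1) ?mulf_neq0 ?invr_eq0 ?gt_eqF //=; last 2 first.
- by rewrite /g1; measurable_poly.
- by apply: (measurableT_comp mF); measurable_poly.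
rewrite (@ge0_integral_shear3 _ e3^-1 (fun q => - rho * q.2)) ?invr_eq0 ?gt_eqF //=; last 2 first.
- by measurable_poly.
- by apply: (measurableT_comp mF); rewrite /g1 /=; measurable_poly.
rewrite (@ge0_integral_shear2 _ e2^-1 (fun=> 0)) ?invr_eq0 ?gt_eqF //=; last first.
- by apply: (measurableT_comp mF); rewrite /g1 /=; measurable_poly.
rewrite normr1 !mul1e !muleA -!EFinM; congr (_ * _)%E.
  rewrite det_C !ger0_norm ?divr_ge0 ?invr_ge0 // ?ltW //.
  by congr EFin; field; rewrite !gt_eqF.
apply: eq_integral => z _; congr F; rewrite /unwhiten /g1 /=.
congr (_, _, _).
all: by field; rewrite !gt_eqF.
Qed.

Definition std_gauss3 (z : R * R * R) : R :=
  expR (- (z.1.1 ^+ 2 + z.1.2 ^+ 2 + z.2 ^+ 2) / 2) / Num.sqrt ((2 * pi) ^+ 3).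

Let mpdf : measurable_fun setT (gauss3_pdf Q C : T1 * T1 * T1 -> T1).
Proof.
have mc i : measurable_fun setT
    ((fun x => (col3 x - Q) i 0) : T1 * T1 * T1 -> T1).
  rewrite (_ : (fun _ => _) = (fun x => col3 x i 0 - Q i 0)).
    by apply: measurable_funB => //; exact: measurable_col3.
  by apply/funext => x; rewrite !mxE.
rewrite /gauss3_pdf; apply: measurable_funM => //.
apply: measurableT_comp => //; apply: measurable_funM => //.
by apply: measurable_funN; exact: measurable_qform.
Qed.

Lemma gauss3_unwhiten (A : set (T1 * T1 * T1)) : measurable A ->
  gauss3 Q C A =
  (\int[lebesgue3]_z (\1_(unwhiten @^-1` A) z * std_gauss3 z)%:E)%E.
Proof.
move=> mA.
have mpdfA : measurable_fun setT ((EFin \o (gauss3_pdf Q C : T1 * T1 * T1 -> T1)) \_ A).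
  have mf : measurable_fun setT (EFin \o (gauss3_pdf Q C : T1 * T1 * T1 -> T1)).
    exact/measurable_EFinP.
  have [h _] := measurable_restrictT (EFin \o (gauss3_pdf Q C : T1 * T1 * T1 -> T1)) mA.
  by apply: h; exact: (measurable_funS measurableT (@subsetT _ _) mf).
rewrite /gauss3 [LHS]integral_mkcond [LHS]ge0_integral_unwhiten; last 2 first.
- exact: mpdfA.
- move=> x; rewrite patchE; case: ifP => // _.
  by rewrite lee_fin divr_ge0 ?expR_ge0 ?sqrtr_ge0.
rewrite -[LHS]ge0_integralZl //; last 2 first.
- exact: (measurableT_comp mpdfA measurable_unwhiten).
- move=> x _; rewrite patchE; case: ifP => // _.
  by rewrite lee_fin divr_ge0 ?expR_ge0 ?sqrtr_ge0.
apply: eq_integral => z _; rewrite patchE -[\1_(_ @^-1` _) z]/(\1_A (unwhiten z)) indicE.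
case: ifPn => _; last by rewrite mule0 mul0r.
rewrite mul1r -EFinM /gauss3_pdf qform_unwhitenB sqrtrM; last first.
  by rewrite exprn_ge0 // mulr_ge0 // pi_ge0.
congr EFin; rewrite /std_gauss3 invfM mulrC -!mulrA mulVf ?mulr1 //.
by rewrite det_C gt_eqF // !divr_gt0.
Qed.

End Standardization.

(** * The tail of the radius of a standard Gaussian vector *)

Section Polar.
Context {R : realType}.
Local Notation mu := (@lebesgue_measure R).
Local Notation T1 := (measurableTypeR R).
Local Open Scope ereal_scope.

Lemma ge0_integral_even (k : R -> \bar R) : measurable_fun setT k ->
  (forall x, 0 <= k x) -> (forall x, k (- x)%R = k x) ->
  \int[mu]_x k x = 2%:E * \int[mu]_(x in `[0%R, +oo[) k x.
Proof.
move=> mk k0 ke.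
have mS (D : set R) : measurable D -> measurable_fun D k.
  by move=> mD; exact: (measurable_funS measurableT (@subsetT _ _) mk).
have kN : \int[mu]_(x in `]-oo, 0%R[) k x = \int[mu]_(x in `[0%R, +oo[) k x.
  rewrite integral_itv_bndo_bndc; last exact: mS.
  rewrite ge0_integration_by_substitution0 //.
  by apply: eq_integral => x _; rewrite ke.
rewrite -{1}(setUv `[0%R, +oo[%classic) ge0_integral_setU //=; last 3 first.
- exact: measurableC.
- by rewrite setUv.
- exact/disj_setPCl.
by rewrite setCitvr kN [2%R]mulr2n EFinD ge0_muleDl ?lee_fin // !mul1e.
Qed.

(** Polar coordinates with the slope t = y / x in place of the angle. The
    substitution y = t x has Jacobian |x| and gives h (x^2 (1 + t^2)); rescaling x
    by (1 + t^2)^(-1/2) separates the variables. The total angle, integral of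
    1 / (1 + t^2), needs no evaluation: it cancels when masses are compared. *)
Lemma ge0_integral_polar (h : R -> \bar R) : measurable_fun setT h ->
  (forall s, 0 <= h s) ->
  \int[mu]_x \int[mu]_y h (x ^+ 2 + y ^+ 2)%R =
  (\int[mu]_t ((1 + t ^+ 2)^-1)%:E) * \int[mu]_u (`|u|%:E * h (u ^+ 2)%R).
Proof.
move=> mh h0.
have mhq (f : T1 * T1 -> T1) : measurable_fun setT f ->
    measurable_fun setT (fun z => h (f z)) by move=> mf; exact: measurableT_comp.
have mh2 : measurable_fun setT (fun z : T1 * T1 => h (z.1 ^+ 2 + z.2 ^+ 2)%R).
  by apply: mhq; measurable_poly.
have mG : measurable_fun setT
    (fun z : T1 * T1 => `|z.1|%:E * h (z.1 ^+ 2 + (z.1 * z.2) ^+ 2)%R).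
  apply: emeasurable_funM; last by apply: mhq; measurable_poly.
  by apply/measurable_EFinP; exact: measurableT_comp.
have G0 (z : T1 * T1) : 0 <= `|z.1|%:E * h (z.1 ^+ 2 + (z.1 * z.2) ^+ 2)%R.
  by rewrite mule_ge0.
transitivity (\int[mu]_x \int[mu]_t (`|x|%:E * h (x ^+ 2 + (x * t) ^+ 2)%R)).
  apply: ge0_ae_eq_integral => //.
  - exact: (measurable_fun_fubini_tonelli_F _ mh2).
  - exact: (measurable_fun_fubini_tonelli_F _ mG).
  - by move=> x _; exact: integral_ge0.
  - by move=> x _; apply: integral_ge0 => y _; rewrite mule_ge0.
  (* the substitution degenerates on the line x = 0, which is negligible *)
  exists [set 0%R]; split => //; first exact: lebesgue_measure_set1.
  move=> x /=; apply: contra_notP => /eqP x0 _.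
  rewrite (@ge0_integral_affine _ x 0) //; last first.
    by apply: (measurableT_comp mh); measurable_poly.
  rewrite -ge0_integralZl //; last first.
    by apply: (measurableT_comp mh); measurable_poly.
  by apply: eq_integral => t _; rewrite addr0.
have mV : measurable_fun setT (fun t : R => (1 + t ^+ 2)^-1)%R.
  by apply: continuous_measurable_fun; exact: continuous_oneDsqrV.
rewrite (fubini_tonelli _ mG G0) /= -ge0_integralZr //; last 3 first.
- by apply/measurable_EFinP.
- by move=> t _; rewrite lee_fin invr_ge0 addr_ge0 ?sqr_ge0.
- by apply: integral_ge0 => u _; rewrite mule_ge0.
have mN (f : T1 -> T1) : measurable_fun setT f ->
    measurable_fun setT (fun u => `|f u|%:E : \bar R).
  by move=> mf; apply/measurable_EFinP; exact: measurableT_comp.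
have mh1 (f : T1 -> T1) : measurable_fun setT f ->
    measurable_fun setT (fun u => h (f u)) by move=> mf; exact: measurableT_comp.
have mI : measurable_fun setT (fun u : T1 => `|u|%:E * h (u ^+ 2)%R).
  by apply: emeasurable_funM; [exact: mN | apply: mh1; measurable_poly].
apply: eq_integral => t _.
pose r := Num.sqrt (1 + t ^+ 2).
have r0 : (0 < r)%R by rewrite sqrtr_gt0 ltr_pwDl ?sqr_ge0.
have r2 : (1 + t ^+ 2 = r ^+ 2)%R by rewrite sqr_sqrtr // addr_ge0 ?sqr_ge0.
rewrite (@ge0_integral_affine _ r^-1 0) ?invr_eq0 ?gt_eqF //; last 2 first.
- by apply: emeasurable_funM; [exact: mN | apply: mh1; measurable_poly].
- by move=> x; exact: (G0 (x, t)).
rewrite r2 -!ge0_integralZl //; last 4 first.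
- by move=> x _; rewrite mule_ge0.
- by rewrite lee_fin invr_ge0 sqr_ge0.
- by apply: emeasurable_funM; [apply: mN | apply: mh1]; measurable_poly.
- by move=> x _; rewrite mule_ge0.
apply: eq_integral => x _; rewrite addr0.
rewrite (_ : (_ + _)%R = (x ^+ 2)%R); last first.
  transitivity ((r^-1 * x) ^+ 2 * (1 + t ^+ 2))%R; first by ring.
  by rewrite r2; field; rewrite gt_eqF.
rewrite normrM gtr0_norm ?invr_gt0 // muleA -EFinM muleA -EFinM.
by congr (_%:E * _); rewrite mulrA -expr2 exprVn.
Qed.

Lemma integral_gauss_tail (a : R) : (0 <= a)%R ->
  \int[mu]_(u in `[a, +oo[) (u * expR (- u ^+ 2 / 2))%:E = (expR (- a ^+ 2 / 2))%:E.
Proof.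
move=> a0.
pose F (u : R) := (- expR (- u ^+ 2 / 2))%R.
have dF (u : R) : is_derive u 1%R F (u * expR (- u ^+ 2 / 2))%R.
  rewrite /F; apply: is_derive_eq.
  rewrite scaler0 scaler0 add0r /GRing.scale /= !mulr1.
  by field.
have cF : continuous F.
  by move=> u; apply: differentiable_continuous; apply/derivable1_diffP; case: (dF u).
have Fy : F u @[u --> +oo%R] --> 0%R.
  rewrite -oppr0; apply: cvgN.
  under eq_cvg do rewrite mulNr.
  apply: (cvg_comp (fun u : R => u ^+ 2 / 2)%R (fun u => expR (- u))); last exact: cvgr_expR.
  by apply: gt0_cvgMly; [rewrite invr_gt0 | exact: cvgr_expr2].
rewrite (@ge0_continuous_FTC2y _ _ F _ 0%R) //.
- by rewrite sub0e -EFinN opprK.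
- by move=> u au; rewrite mulr_ge0 ?expR_ge0 // (le_trans a0).
- apply: continuous_subspaceT.
  move=> u; apply: differentiable_continuous; apply/derivable1_diffP.
  exact: ex_derive.
- by apply: cvg_at_right_filter; exact: cF.
- by move=> u _; rewrite derive1E; apply: derive_val.
Qed.

(** The density of the standard normal law of the plane as a function of the
    squared radius, cut off below L. *)
Definition radial_tail (L s : R) : \bar R :=
  ((L <= s)%R%:R * (expR (- s / 2) / (2 * pi)))%:E.

Lemma radial_tail_ge0 L s : 0 <= radial_tail L s.
Proof. by rewrite lee_fin mulr_ge0 // divr_ge0 ?expR_ge0 // mulr_ge0 // pi_ge0. Qed.

Lemma measurable_radial_tail L : measurable_fun setT (radial_tail L).
Proof.
apply/measurable_EFinP; apply: measurable_funM.
  rewrite (_ : (fun s => _) = \1_[set s | (L <= s)%R]).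
    apply: measurable_indic; rewrite (_ : [set _ | _] = `[L, +oo[%classic) //.
    by apply/seteqP; split => x /=; rewrite in_itv /= andbT.
  apply/funext => s; rewrite indicE; congr (nat_of_bool _)%:R.
  by apply/idP/idP => [?|/set_mem]; first exact: mem_set.
apply: measurable_funM => //; apply: measurableT_comp => //.
by measurable_poly.
Qed.

Lemma normal_pdf01 (x : R) : normal_pdf 0 1 x = (expR (- x ^+ 2 / 2) / Num.sqrt (2 * pi))%R.
Proof.
rewrite normal_pdfE ?oner_eq0 // /normal_peak /normal_fun expr1n mul1r subr0.
by rewrite mulrC (mulr_natl pi 2).
Qed.

Let radial_moment L : (0 <= L)%R ->
  \int[mu]_u (`|u|%:E * radial_tail L (u ^+ 2)%R) = (pi^-1 * expR (- L / 2))%:E.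
Proof.
move=> L0.
rewrite ge0_integral_even; last 3 first.
- apply: emeasurable_funM; first by apply/measurable_EFinP; exact: normr_measurable.
  by apply: (measurableT_comp (measurable_radial_tail L)); measurable_poly.
- by move=> x; rewrite mule_ge0 // radial_tail_ge0.
- by move=> x; rewrite normrN sqrrN.
transitivity (2%:E * (((2 * pi)^-1)%:E * \int[mu]_(u in `[Num.sqrt L, +oo[) (u * expR (- u ^+ 2 / 2))%:E)).
  have xE (a x : R) : (x \in `[a, +oo[%classic) = (a <= x)%R.
    by rewrite mem_setE in_itv /= andbT.
  congr (_ * _); rewrite integral_mkcond [in RHS]integral_mkcond.
  rewrite -ge0_integralZl //; last 3 first.
  - have [+ _] := measurable_restrictT
      (fun u : T1 => (u * expR (- u ^+ 2 / 2))%:E) (measurable_itv `[Num.sqrt L, +oo[).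
    apply; apply/measurable_EFinP; apply: measurable_funM => //.
    by apply: measurableT_comp => //; measurable_poly.
  - move=> x _; rewrite patchE xE; case: ifPn => // xL.
    by rewrite lee_fin mulr_ge0 ?expR_ge0 // (le_trans _ xL) // sqrtr_ge0.
  - by rewrite lee_fin invr_ge0 mulr_ge0 // pi_ge0.
  apply: eq_integral => x _; rewrite !patchE !xE.
  case: (lerP 0 x) => x0; last first.
    by rewrite leNgt (lt_le_trans x0 (sqrtr_ge0 _)) mule0.
  have -> : (Num.sqrt L <= x)%R = (L <= x ^+ 2)%R.
    by rewrite -[in RHS](sqr_sqrtr L0) ler_sqr ?nnegrE ?sqrtr_ge0.
  rewrite /radial_tail ger0_norm //.
  case: ifP => _; last by rewrite mul0r !mule0.
  by rewrite mul1r -!EFinM; congr EFin; ring.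
rewrite integral_gauss_tail ?sqrtr_ge0 // sqr_sqrtr // muleA -!EFinM.
by congr (_ * _)%:E; rewrite invfM mulrA divff ?mul1r.
Qed.

(** Both sides are proportional as functions of L, by polar coordinates, and equal
    at L = 0, where the left one is the total mass of a product of normal laws. *)
Lemma integral_radial_tail L : (0 <= L)%R ->
  \int[mu]_x \int[mu]_y radial_tail L (x ^+ 2 + y ^+ 2)%R = (expR (- L / 2))%:E.
Proof.
move=> L0.
have tailE l : (0 <= l)%R ->
    \int[mu]_x \int[mu]_y radial_tail l (x ^+ 2 + y ^+ 2)%R =
    (\int[mu]_t ((1 + t ^+ 2)^-1)%:E) * (pi^-1)%:E * (expR (- l / 2))%:E.
  move=> l0; rewrite ge0_integral_polar; last 2 first.
  - exact: measurable_radial_tail.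
  - exact: radial_tail_ge0.
  by rewrite radial_moment // EFinM muleA.
have tail0 : \int[mu]_x \int[mu]_y radial_tail 0 (x ^+ 2 + y ^+ 2)%R = 1.
  under eq_integral => x _.
    under eq_integral => y _.
      rewrite /radial_tail addr_ge0 ?sqr_ge0 // mul1r.
      rewrite (_ : (_ / _)%R = (normal_pdf 0 1 x * normal_pdf 0 1 y)%R); last first.
        rewrite !normal_pdf01 mulrACA -expRD -invfM -expr2 sqr_sqrtr.
          by congr (expR _ / _)%R; field.
        by rewrite mulr_ge0 // pi_ge0.
      rewrite EFinM; over.
    rewrite ge0_integralZl //; last 3 first.
    - by apply/measurable_EFinP; exact: measurable_normal_pdf.
    - by move=> y _; rewrite lee_fin normal_pdf_ge0.
    - by rewrite lee_fin normal_pdf_ge0.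
    rewrite integral_normal_pdf mule1; over.
  by rewrite integral_normal_pdf.
have := tailE 0%R (lexx _); rewrite tail0 oppr0 mul0r expR0 mule1 => K1.
by rewrite tailE // -K1 mul1e.
Qed.

Lemma std_gauss3E (z : R * R * R) : std_gauss3 z =
  (normal_pdf 0 1 z.1.1 * (expR (- (z.2 ^+ 2 + z.1.2 ^+ 2) / 2) / (2 * pi)))%R.
Proof.
have pi2 : (0 <= 2 * pi :> R)%R by rewrite mulr_ge0 // pi_ge0.
rewrite normal_pdf01 /std_gauss3 mulrACA -expRD -invfM; congr (expR _ / _)%R; first by field.
by rewrite exprSr mulrC sqrtrM // sqrtr_sqr ger0_norm // mulrC.
Qed.

Definition outside_cylinder (L : R) : set (T1 * T1 * T1) :=
  [set z | (L <= z.1.2 ^+ 2 + z.2 ^+ 2)%R].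

Lemma measurable_outside_cylinder L : measurable (outside_cylinder L).
Proof.
rewrite -[outside_cylinder L]setTI /outside_cylinder.
have mf : measurable_fun setT (fun z : T1 * T1 * T1 => z.1.2 ^+ 2 + z.2 ^+ 2)%R.
  by measurable_poly.
rewrite (_ : [set _ | _] = (fun z : T1 * T1 * T1 => z.1.2 ^+ 2 + z.2 ^+ 2)%R @^-1` `[L, +oo[).
  exact: mf.
by apply/seteqP; split => x /=; rewrite in_itv /= andbT.
Qed.

Lemma std_gauss3_ge0 (z : R * R * R) : (0 <= std_gauss3 z)%R.
Proof. by rewrite /std_gauss3 divr_ge0 ?expR_ge0 ?sqrtr_ge0. Qed.

Lemma measurable_std_gauss3 : measurable_fun setT (std_gauss3 : T1 * T1 * T1 -> T1).
Proof.
rewrite /std_gauss3; apply: measurable_funM => //.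
by apply: measurableT_comp => //; measurable_poly.
Qed.

Lemma measurable_indic_std_gauss3 (D : set (T1 * T1 * T1)) : measurable D ->
  measurable_fun setT (fun z : T1 * T1 * T1 => (\1_D z * std_gauss3 z)%:E).
Proof.
move=> mD; apply/measurable_EFinP.
by apply: measurable_funM; [exact: measurable_indic | exact: measurable_std_gauss3].
Qed.

Lemma std_gauss3_tail (L : R) : (0 <= L)%R ->
  \int[lebesgue3]_z (\1_(outside_cylinder L) z * std_gauss3 z)%:E = (expR (- L / 2))%:E.
Proof.
move=> L0; rewrite -(integral_radial_tail L0).
have mF := measurable_indic_std_gauss3 (measurable_outside_cylinder L).
rewrite integral_lebesgue3_12; last 2 first.
- exact: mF.
- by move=> z; rewrite lee_fin mulr_ge0 // std_gauss3_ge0.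
apply: eq_integral => w _; rewrite integral_lebesgue2_1; last 2 first.
- by apply: (measurableT_comp mF); exact: measurable_fun_pair.
- by move=> z; rewrite lee_fin mulr_ge0 // std_gauss3_ge0.
apply: eq_integral => y _.
under eq_integral => x _.
  rewrite std_gauss3E /= mulrCA EFinM (_ : (_ * (_ / _))%:E = radial_tail L (w ^+ 2 + y ^+ 2)%R); last first.
    rewrite /radial_tail indicE; congr ((nat_of_bool _)%:R * _)%:E.
    by rewrite addrC; apply/idP/idP => [/set_mem //|?]; exact: mem_set.
  over.
rewrite ge0_integralZr ?radial_tail_ge0 //.
- by rewrite integral_normal_pdf mul1e.
- by apply/measurable_EFinP; exact: measurable_normal_pdf.
- by move=> x _; rewrite lee_fin normal_pdf_ge0.
Qed.

End Polar.

(** * Directions seen by the anisotropy statistics *)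

Section AnisotropyStatistics.
Context {R : realType}.
Implicit Types (x : R * R * R) (Q : 'cV[R]_3) (C : 'M[R]_3).

Definition cone : set (R * R * R) :=
  [set x | 0 < x.1.1 /\ 0 < x.1.1 * x.1.2 - x.2 ^+ 2].

(** The slopes t of the eigenvectors (1, t) of the matrix ((a, b), (b, d)). Their
    product is -1, so one lies in [-1, 1); the value 1 occurs only with a = d,
    when -1 is a slope as well. *)
Lemma principal_slope (a b d : R) :
  exists2 t : R, -1 <= t < 1 & b * t ^+ 2 + (a - d) * t - b = 0.
Proof.
have [->|ad] := eqVneq a d.
  by exists (-1); [rewrite lexx; lra | ring].
pose p : {poly R} := b *: 'X ^+ 2 + (a - d) *: 'X - b%:P.
have pE t : p.[t] = b * t ^+ 2 + (a - d) * t - b by rewrite /p !hornerE.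
have p1 : p.[1] = a - d by rewrite pE; ring.
have pN1 : p.[-1] = - (a - d) by rewrite pE; ring.
have [t /andP[tN1 t1] /rootP pt] : exists2 t, -1 <= t <= 1 & root p t.
  have [ad0|ad0] := leP 0 (a - d).
    by apply: poly_ivt; [lra | rewrite p1 pN1 oppr_le0 ad0].
  have [t tI] : exists2 t, -1 <= t <= 1 & root (- p) t.
    by apply: poly_ivt; [lra | rewrite !hornerN p1 pN1 opprK oppr_ge0 ltW].
  by rewrite rootN; exists t.
exists t; last by rewrite -pE.
rewrite tN1 lt_neqAle t1 andbT; apply: contra ad => /eqP t1E.
by rewrite -subr_eq0 -p1 -t1E pt.
Qed.

(** The right-hand sides of the system are the entries of
    R^2 u u^t + v v^t with u = (1, t), v = (- t, 1) and t = tan theta, divided by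
    the first entry. Hence t must be the slope of an eigenvector and R^2 the ratio
    of the eigenvalues, which is positive on the cone. *)
Lemma solvable_on_cone x : cone x -> exists rt, solves x rt.
Proof.
case: x => [[a d] b] [/= a0]; rewrite subr_gt0 => abd.
have [t /andP[tN1 t1] tE] := principal_slope a b d.
have bt2 : b * t ^+ 2 = b - (a - d) * t.
  by move/eqP: tE; rewrite subr_eq0 => /eqP tb; rewrite -[X in _ = X - _]tb addrK.
have d0 : 0 < d.
  by rewrite -(pmulr_rgt0 _ a0); apply: le_lt_trans abd; exact: sqr_ge0.
(* the eigenvalues of (1, t) and (- t, 1) *)
have mM : (a + b * t) * (d - b * t) = a * d - b ^+ 2.
  transitivity (a * d - b * (b * t ^+ 2 + (a - d) * t)); first by ring.
  by rewrite bt2; ring.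
have mM0 : 0 < (a + b * t) * (d - b * t) by rewrite mM subr_gt0.
have [m1 m2] : 0 < a + b * t /\ 0 < d - b * t.
  have s0 : 0 < (a + b * t) + (d - b * t) by rewrite addrACA subrr addr0 addr_gt0.
  have [m1|m1] := ltP 0 (a + b * t); first by split => //; rewrite -(pmulr_rgt0 _ m1).
  have m2 : 0 < d - b * t by lra.
  by move: mM0; rewrite pmulr_lgt0 // ltNge m1.
pose r := Num.sqrt ((a + b * t) / (d - b * t)).
have r2 : r ^+ 2 = (a + b * t) / (d - b * t) by rewrite sqr_sqrtr // divr_ge0 // ltW.
have t2 : 0 < 1 + t ^+ 2 by rewrite ltr_pwDl // sqr_ge0.
have r0 : 0 < r ^+ 2 by rewrite r2 divr_gt0.
have tt : tan (atan t) = t by exact: atanK.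
have den0 : r ^+ 2 + t ^+ 2 != 0 by rewrite gt_eqF // ltr_wpDr // sqr_ge0.
have den1 : a + b * t + t ^+ 2 * (d - b * t) = a * (1 + t ^+ 2).
  transitivity (a + b * t + d * t ^+ 2 - t * (b * t ^+ 2)); first by ring.
  by rewrite bt2; ring.
have num1 : d - b * t + (a + b * t) * t ^+ 2 = d * (1 + t ^+ 2).
  transitivity (d - b * t + a * t ^+ 2 + t * (b * t ^+ 2)); first by ring.
  by rewrite bt2; ring.
have num2 : t * (a - d + 2 * b * t) = b * (1 + t ^+ 2).
  transitivity ((a - d) * t + 2 * (b * t ^+ 2)); first by ring.
  by rewrite mulrDr mulr1 bt2; ring.
exists (r, atan t); split => /=.
- split => /=; rewrite ?sqrtr_ge0 ?/denom //= ?tt //.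
    by rewrite mulNr -atan1 -atanN; exact: le_atan.
  by rewrite -atan1; exact: lt_atan.
- by rewrite gt_eqF.
- rewrite /q_d /denom /= tt r2.
  transitivity ((d - b * t + (a + b * t) * t ^+ 2) / (a + b * t + t ^+ 2 * (d - b * t))).
    by rewrite num1 den1; field; rewrite !gt_eqF.
  by field; rewrite gt_eqF // den1 gt_eqF // mulr_gt0.
- rewrite /q_o /denom /= tt r2.
  transitivity (t * (a - d + 2 * b * t) / (a + b * t + t ^+ 2 * (d - b * t))).
    by rewrite num2 den1; field; rewrite !gt_eqF.
  by field; rewrite gt_eqF // den1 gt_eqF // mulr_gt0.
Qed.

(** Minus half the squared distance, for the form of C^-1, from Q to the line
    spanned by x. *)
Definition profile Q C x : R :=
  (qform (invmx C) Q (col3 x) ^+ 2 / qform (invmx C) (col3 x) (col3 x)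
   - qform (invmx C) Q Q) / 2.

Lemma level_fun_profile N Q C x rt : (0 < N)%N ->
  C^T = C -> positive_definite C -> solves x rt ->
  level_fun N Q C rt = profile Q C x.
Proof.
move=> N0 Cs Cpos [_ x1 xd xo].
have xq : col3 x = x.1.1 *: qprime rt.
  apply/colP => i; rewrite !mxE; case: i => [[|[|[|//]]]] /= _.
  - by rewrite mulr1.
  - by rewrite -xd mulrC divfK.
  - by rewrite -xo mulrC divfK.
have q0 : 0 < qform (invmx C) (qprime rt) (qprime rt).
  apply: positive_definite_invmx => //; apply/eqP => /colP /(_ 0).
  by rewrite !mxE /= => /eqP; rewrite oner_eq0.
rewrite /profile xq !(qformZl, qformZr) /level_fun /y_stat /lambda1.
move: q0; set S := qform _ (qprime rt) _; set T := qform _ Q (qprime rt) => q0.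
have NR : N%:R != 0 :> R by rewrite pnatr_eq0 -lt0n.
rewrite !exprMn !exprVn exprMn !sqr_sqrtr ?ler0n ?(ltW q0) // sqrrN.
by field; rewrite x1 NR gt_eqF.
Qed.

(** The condition that the squared distance from Q to the line of x is at most L,
    cleared of its denominator, so that it is polynomial in x. *)
Definition near_mean (L : R) Q C : set (R * R * R) := [set x |
  0 <= qform (invmx C) Q (col3 x) ^+ 2
       + (L - qform (invmx C) Q Q) * qform (invmx C) (col3 x) (col3 x)].

Lemma region_cone p N Q C st x : (0 < N)%N ->
  C^T = C -> positive_definite C -> anisotropy_statistics st -> cone x ->
  region p N Q C (st x) <-> near_mean (-2 * ln (1 - p)) Q C x.
Proof.
move=> N0 Cs Cpos [_ stP] cx; have [x1 _] := cx.
have /stP sx := solvable_on_cone cx.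
have x0 : 0 < qform (invmx C) (col3 x) (col3 x).
  apply: positive_definite_invmx => //; apply/eqP => /colP /(_ 0).
  by rewrite !mxE /= => x10; move: x1; rewrite x10 ltxx.
suff E : (ln (1 - p) <= profile Q C x) =
    (0 <= qform (invmx C) Q (col3 x) ^+ 2 + (-2 * ln (1 - p) - qform (invmx C) Q Q)
          * qform (invmx C) (col3 x) (col3 x)).
  rewrite /region /near_mean /= (level_fun_profile _ N0 Cs Cpos sx) -E.
  by split => [[]|] //; case: sx.
rewrite /profile.
set A := qform _ Q (col3 x); move: x0; set B := qform _ _ _ => B0.
set S := qform _ Q Q; set l := ln _.
rewrite ler_pdivlMr // lerBrDr ler_pdivlMr // -subr_ge0.
by congr (0 <= _); ring.
Qed.

End AnisotropyStatistics.

(** * Positive definiteness of the mean gradient tensor *)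

Section Nondegeneracy.
Context {d : measure_display} {T : measurableType d} {R : realType}.
Variable P : probability T R.
Local Open Scope ereal_scope.

(** The integral is the difference of those of the positive and negative parts,
    and by convention a difference with an infinite term, even of two infinite
    terms, is infinite. *)
Lemma integrable_of_fin_num (f : T -> R) : measurable_fun setT f ->
  \int[P]_w (f w)%:E \is a fin_num -> P.-integrable setT (EFin \o f).
Proof.
move=> mf; rewrite integralE fin_numB => /andP[fp fn].
have mEf : measurable_fun setT (EFin \o f) by exact/measurable_EFinP.
apply/integrableP; split => //.
have -> : \int[P]_w `|(EFin \o f) w| =
    \int[P]_w ((EFin \o f)^\+ \+ (EFin \o f)^\-) w by rewrite -fune_abse.
rewrite ge0_integralD //; last 2 first.
- exact: measurable_funepos.
- exact: measurable_funeneg.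
by rewrite ltey_eq fin_numD fp fn.
Qed.

Lemma integral_lincomb (I : finType) (Z : I -> T -> R) (v m : I -> R) :
  (forall i, measurable_fun setT (Z i)) ->
  (forall i, \int[P]_w (Z i w)%:E = (m i)%:E) ->
  \int[P]_w (\sum_i v i * Z i w)%:E = (\sum_i v i * m i)%:E.
Proof.
move=> mZ Zm; have iZ i : P.-integrable setT (EFin \o Z i).
  by apply: integrable_of_fin_num => //; rewrite Zm.
under eq_integral do rewrite -sumEFin.
rewrite integral_sum //; last first.
  by move=> i; exact: (integrableZl measurableT (v i) (iZ i)).
rewrite -sumEFin; apply: eq_bigr => i _.
under eq_integral do rewrite EFinM.
by rewrite integralZl ?Zm //; exact: iZ.
Qed.

Lemma integral_lincomb2 n (Z : 'I_n -> T -> R) (v : 'I_n -> R) (C : 'M[R]_n) :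
  (forall i, measurable_fun setT (Z i)) ->
  (forall i j, \int[P]_w (Z i w * Z j w)%:E = (C i j)%:E) ->
  \int[P]_w ((\sum_i v i * Z i w) ^+ 2)%:E = (\sum_i \sum_j v i * v j * C i j)%:E.
Proof.
move=> mZ ZC.
transitivity (\int[P]_w (\sum_(k : 'I_n * 'I_n)
    (v k.1 * v k.2) * (Z k.1 w * Z k.2 w))%:E).
  apply: eq_integral => w _; congr EFin.
  rewrite -(pair_bigA _ (fun i j => (v i * v j) * (Z i w * Z j w)))%R /=.
  rewrite expr2 mulr_suml; apply: eq_bigr => i _; rewrite mulr_sumr.
  by apply: eq_bigr => j _; ring.
rewrite (@integral_lincomb _ _ _ (fun k : 'I_n * 'I_n => C k.1 k.2)) //.
- by rewrite -(pair_bigA _ (fun i j => (v i * v j) * C i j))%R.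
- by move=> k; exact: measurable_funM.
Qed.

Lemma covariance_matrix_null (Y : 'I_3 -> T -> R) (C : 'M[R]_3) (v : 'cV[R]_3) :
  (forall i, measurable_fun setT (Y i)) -> is_covariance_matrix P Y C ->
  (\forall w \ae P, \sum_i v i 0 * (Y i w - fine ('E_P[Y i])) = 0)%R ->
  qform C v v = 0%R.
Proof.
move=> mY YC v0.
pose Z i w := (Y i w - fine ('E_P[Y i]))%R.
have mZ i : measurable_fun setT (Z i) by apply: measurable_funB.
have ZC i j : \int[P]_w (Z i w * Z j w)%:E = (C i j)%:E.
  by rewrite -YC unlock /Z unlock.
have := integral_lincomb2 (fun i => v i 0)%R mZ ZC.
rewrite (_ : \int[P]_w _ = 0); last first.
  transitivity (\int[P]_w (cst 0 w)); last exact: integral0.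
  apply: ae_eq_integral => //.
    apply/measurable_EFinP/measurable_funX.
    by apply: measurable_sum => i; exact: measurable_funM.
  by apply: filterS v0 => w w0 _; rewrite w0 expr0n.
move=> /esym [] <-; rewrite /qform mxE.
transitivity (\sum_j \sum_i v i 0 * v j 0 * C i j)%R.
  by apply: eq_bigr => j _; rewrite !mxE mulr_suml; apply: eq_bigr => i _; rewrite !mxE; ring.
by rewrite exchange_big.
Qed.

Variables (dX : 'I_2 -> R * R -> {RV P >-> R}) (u : R * R).
Variables (Q : 'cV[R]_3) (C : 'M[R]_3).
Hypothesis QE : forall a, 'E_P[Xprod dX a u] = (Q a 0%R)%:E.
Hypothesis CE : is_covariance_matrix P (fun a => Xprod dX a u) C.
Hypothesis Cpos : positive_definite C.

Let mX a : measurable_fun setT (Xprod dX a u).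
Proof. by apply: measurable_funM; exact: measurable_funPT. Qed.

(** The left-hand side is the mean of (a d_1 X + b d_2 X)^2. If it vanished, this
    square would vanish almost surely, and so would the linear combination of the
    three products with coefficients (a^2, b^2, 2 a b). *)
Lemma gradient_form_gt0 (a b : R) : (a != 0)%R || (b != 0)%R ->
  (0 < a ^+ 2 * Q 0 0 + b ^+ 2 * Q 1 0 + 2 * a * b * Q 2 0)%R.
Proof.
move=> ab; pose v : 'cV[R]_3 := col3 (a ^+ 2, b ^+ 2, 2 * a * b)%R.
have v0 : (v != 0)%R.
  apply: contraL ab => /eqP/colP v0; have := v0 0%R; have := v0 1%R.
  by rewrite !mxE /= => /eqP; rewrite sqrf_eq0 => -> /eqP; rewrite sqrf_eq0 => ->.
have sum3 (F : 'I_3 -> R) : (\sum_i v i 0 * F i =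
    a ^+ 2 * F 0 + b ^+ 2 * F 1 + 2 * a * b * F 2)%R.
  rewrite !big_ord_recl big_ord0 !mxE /= addr0 addrA.
  by congr (_ + _ * F _ + _ * F _)%R; exact: val_inj.
have sq w : (\sum_i v i 0 * Xprod dX i u w =
    (a * dX 0 u w + b * dX 1 u w) ^+ 2)%R.
  by rewrite sum3 /Xprod /pair_of /=; ring.
have S0 w : (0 <= \sum_i v i 0 * Xprod dX i u w)%R by rewrite sq sqr_ge0.
have EV : \int[P]_w (\sum_i v i 0 * Xprod dX i u w)%R%:E =
    (\sum_i v i 0 * Q i 0)%R%:E.
  by apply: integral_lincomb => // i; rewrite -QE unlock.
have V0 : (0 <= \sum_i v i 0 * Q i 0)%R.
  by rewrite -lee_fin -EV; apply: integral_ge0 => w _; rewrite lee_fin sq sqr_ge0.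
rewrite -(sum3 (fun i => Q i 0)%R) lt_neqAle V0 andbT eq_sym; apply/negP => /eqP VE0.
have : qform C v v = 0%R.
  apply: (covariance_matrix_null mX CE).
  have : ae_eq P setT (fun w => (\sum_i v i 0 * Xprod dX i u w)%R%:E) (cst 0).
    apply/ae_eq_integral_abs => //.
      by apply/measurable_EFinP; apply: measurable_sum => i; exact: measurable_funM.
    transitivity (\int[P]_w (\sum_i v i 0 * Xprod dX i u w)%R%:E); last by rewrite EV VE0.
    apply: eq_integral => w _.
    by rewrite /= ger0_norm.
  apply: filterS => w /(_ I) /= [] w0.
  under eq_bigr do rewrite mulrBr QE.
  by rewrite sumrB /= VE0 w0 subr0.
by apply/eqP; rewrite gt_eqF // Cpos.
Qed.

Lemma gradient_cone : (0 < Q 0 0)%R /\ (Q 2 0 ^+ 2 < Q 0 0 * Q 1 0)%R.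
Proof.
have Q0 : (0 < Q 0 0)%R.
  have := @gradient_form_gt0 1%R 0%R; rewrite oner_eq0 => /(_ isT) h.
  by apply: etrans h; congr (0 < _)%R; ring.
split => //.
rewrite -subr_gt0 -(pmulr_rgt0 _ Q0).
have := @gradient_form_gt0 (- Q 2 0)%R (Q 0%R 0%R); rewrite (gt_eqF Q0) orbT => /(_ isT) h.
by apply: etrans h; congr (0 < _)%R; ring.
Qed.

End Nondegeneracy.

(** * Monotonicity in an arbitrary domain of integration *)

Section MonotoneIntegral.
Context {d : measure_display} {T : measurableType d} {R : realType}.
Variable mu : {measure set T -> \bar R}.
Local Open Scope ereal_scope.
Import HBNNSimple.

(** The integral of a nonnegative function is a supremum over the simple functions
    below it, which is monotone whether or not the domains are measurable. *)
Lemma ge0_le_integral_subset (A B : set T) (f : T -> \bar R) :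
  (forall x, 0 <= f x) -> A `<=` B ->
  \int[mu]_(x in A) f x <= \int[mu]_(x in B) f x.
Proof.
move=> f0 AB; have p0 D x : 0 <= (f \_ D) x by rewrite patchE; case: ifP.
rewrite integral_mkcond [leRHS]integral_mkcond !ge0_integralTE //.
apply: le_ereal_sup => _ [h /= hA <-]; exists h => //= x.
apply: le_trans (hA x) _; rewrite !patchE.
by case: ifPn => [/set_mem/AB/mem_set -> //|_]; case: ifP.
Qed.

End MonotoneIntegral.

(** * Limits under the standard Gaussian law *)

Section GaussianLimit.
Context {R : realType}.
Local Notation mu := (@lebesgue_measure R).
Local Notation T1 := (measurableTypeR R).
Local Notation T3 := (T1 * T1 * T1)%type.
Local Open Scope ereal_scope.

Lemma integral_std_gauss3 : \int[lebesgue3]_z (std_gauss3 (z : T3))%:E = 1 :> \bar R.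
Proof.
have := @std_gauss3_tail R _ (lexx 0%R); rewrite oppr0 mul0r expR0 => <-.
apply: eq_integral => z _; rewrite indicE mem_set ?mul1r //.
by rewrite /outside_cylinder /= addr_ge0 ?sqr_ge0.
Qed.

Lemma integral_std_gauss3_inside (L : R) : (0 <= L)%R ->
  \int[lebesgue3]_z (\1_(~` outside_cylinder L) z * std_gauss3 z)%:E = (1 - expR (- L / 2))%:E.
Proof.
move=> L0.
have mS := @measurable_indic_std_gauss3 R.
have std_ge0 := @std_gauss3_ge0 R.
have h : \int[lebesgue3]_z (\1_(~` outside_cylinder L) z * std_gauss3 z)%:E +
    (expR (- L / 2))%:E = 1.
  rewrite -(std_gauss3_tail L0) -ge0_integralD //; last 4 first.
  - by move=> z _; rewrite lee_fin mulr_ge0.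
  - by apply: mS; apply: measurableC; exact: measurable_outside_cylinder.
  - by move=> z _; rewrite lee_fin mulr_ge0.
  - by apply: mS; exact: measurable_outside_cylinder.
  rewrite -integral_std_gauss3; apply: eq_integral => z _.
  rewrite -EFinD -mulrDl; congr EFin.
  by rewrite !indicE in_setC; case: (_ \in _); rewrite /= ?add0r ?addr0 mul1r.
by rewrite EFinB -h addeK.
Qed.

(** Each section in the last coordinate consists of at most two points. *)
Lemma lebesgue3_cylinder (L : R) :
  lebesgue3 [set z : T3 | z.1.2 ^+ 2 + z.2 ^+ 2 = L]%R = 0.
Proof.
set D := [set z : T3 | _].
transitivity (\int[@lebesgue2 R]_q mu (xsection D q)); first by [].
apply: integral0_eq => q _.
apply: countable_lebesgue_measure0; apply: finite_set_countable.
apply: (@sub_finite_set _ _ [set Num.sqrt (L - q.2 ^+ 2); - Num.sqrt (L - q.2 ^+ 2)]%R).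
  move=> w; rewrite /xsection /D /= inE /= => <-; rewrite addrC addKr sqrtr_sqr.
  by case: (lerP 0 w) => w0; [left; rewrite ger0_norm | right; rewrite ltr0_norm // opprK].
exact: finite_set2.
Qed.

(** Dominated convergence: the indicators converge off the boundary of the cylinder,
    which is negligible. *)
Lemma cvg_std_gauss3 (A : nat -> set T3) (L : R) : (0 <= L)%R ->
  (forall N, measurable (A N)) ->
  (forall z, (z.1.2 ^+ 2 + z.2 ^+ 2 < L)%R -> \forall N \near \oo, A N z) ->
  (forall z, (L < z.1.2 ^+ 2 + z.2 ^+ 2)%R -> \forall N \near \oo, ~ A N z) ->
  \int[lebesgue3]_z (\1_(A N) z * std_gauss3 z)%:E @[N --> \oo] -->
  (1 - expR (- L / 2))%:E.
Proof.
move=> L0 mA Ain Aout; rewrite -(integral_std_gauss3_inside L0).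
have mS := @measurable_indic_std_gauss3 R.
have std_ge0 := @std_gauss3_ge0 R.
have [] // := @dominated_convergence _ _ _ (@lebesgue3 R) setT measurableT
  (fun N z => (\1_(A N) z * std_gauss3 z)%:E)
  (fun z => (\1_(~` outside_cylinder L) z * std_gauss3 z)%:E)
  (fun z => (std_gauss3 z)%:E).
- by move=> N; exact: mS.
- by apply: mS; apply: measurableC; exact: measurable_outside_cylinder.
- exists [set z : T3 | z.1.2 ^+ 2 + z.2 ^+ 2 = L]%R; split => //.
  + rewrite -[X in measurable X]setTI.
    have mr : measurable_fun setT (fun z : T3 => z.1.2 ^+ 2 + z.2 ^+ 2)%R by measurable_poly.
    exact: (mr measurableT [set L] (measurable_set1 L)).
  + exact: lebesgue3_cylinder.
  move=> z /=; apply: contra_notP => /eqP zL _.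
  rewrite indicE in_setC; have [zl|zl|zl] := ltgtP (z.1.2 ^+ 2 + z.2 ^+ 2)%R L;
    last by rewrite zl eqxx in zL.
    rewrite memNset; last by rewrite /outside_cylinder /= leNgt zl.
    apply: cvg_near_cst; apply: filterS (Ain _ zl) => N ANz.
    by rewrite indicE mem_set.
  rewrite mem_set; last by rewrite /outside_cylinder /= ltW.
  apply: cvg_near_cst; apply: filterS (Aout _ zl) => N ANz.
  by rewrite indicE memNset.
- apply/integrableP; split.
    by apply/measurable_EFinP; exact: measurable_std_gauss3.
  under eq_integral do rewrite /= ger0_norm //.
  by rewrite integral_std_gauss3 ltry.
- apply: aeW => z N _; rewrite /= ger0_norm ?mulr_ge0 // lee_fin.
  by rewrite indicE; case: (_ \in _); rewrite ?mul1r ?mul0r.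
Qed.

End GaussianLimit.

(** * The probability of the region *)

Section Asymptotics.
Context {R : realType}.
Local Notation T1 := (measurableTypeR R).
Local Notation T3 := (T1 * T1 * T1)%type.
Implicit Types (Q : 'cV[R]_3) (C : 'M[R]_3) (L : R).

Lemma measurable_set_ge0 (f : T3 -> T1) : measurable_fun setT f ->
  measurable [set x | 0 <= f x].
Proof.
move=> mf; rewrite -[X in measurable X]setTI.
rewrite (_ : [set _ | _] = f @^-1` `[0, +oo[); first exact: mf.
by apply/seteqP; split => x /=; rewrite in_itv /= andbT.
Qed.

Lemma measurable_set_gt0 (f : T3 -> T1) : measurable_fun setT f ->
  measurable [set x | 0 < f x].
Proof.
move=> mf; rewrite -[X in measurable X]setTI.
rewrite (_ : [set _ | _] = f @^-1` `]0, +oo[); first exact: mf.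
by apply/seteqP; split => x /=; rewrite in_itv /= andbT.
Qed.

Lemma measurable_cone : measurable (cone : set T3).
Proof.
by apply: measurableI; apply: measurable_set_gt0; measurable_poly.
Qed.

Lemma measurable_near_mean L Q C : measurable (near_mean L Q C : set T3).
Proof.
apply: measurable_set_ge0; apply: measurable_funD.
  apply: measurable_funX; apply: measurable_qform => //; exact: measurable_col3.
by apply: measurable_funM => //; apply: measurable_qform; exact: measurable_col3.
Qed.

Lemma unwhiten_near_mean C Q L z : C^T = C -> positive_definite C -> 0 < Q 0 0 ->
  let n := Num.sqrt (qform (invmx C) Q Q) in
  near_mean L Q C (unwhiten C Q z) <->
  n ^+ 2 * (z.1.2 ^+ 2 + z.2 ^+ 2) <=
    L * ((n + z.1.1) ^+ 2 + (z.1.2 ^+ 2 + z.2 ^+ 2)).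
Proof.
move=> Cs Cpos Q0 n.
have Q00 : 0 <= qform (invmx C) Q Q.
  have [->|Qn0] := eqVneq Q 0; first by rewrite /qform mulmx0 mxE.
  exact/ltW/positive_definite_invmx.
rewrite /near_mean /= qform_mean_unwhiten // qform_unwhiten // -/n -(sqr_sqrtr Q00) -/n.
set r := z.1.2 ^+ 2 + _; rewrite -addrA -/r -[X in _ <-> is_true X]subr_ge0.
have -> : (n * (n + z.1.1)) ^+ 2 + (L - n ^+ 2) * ((n + z.1.1) ^+ 2 + r) =
  L * ((n + z.1.1) ^+ 2 + r) - n ^+ 2 * r by ring.
by [].
Qed.

(** The two sides compare like r and L at order n^2, the remaining terms being at
    most linear in n. *)
Lemma satisfied_eventually L (r z : R) : 0 <= r -> r < L ->
  exists B, forall n, B <= n -> n ^+ 2 * r <= L * ((n + z) ^+ 2 + r).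
Proof.
move=> r0 rL; have L0 : 0 <= L by rewrite ltW // (le_lt_trans r0).
have Lz : 0 <= 2 * L * `|z| by rewrite !mulr_ge0.
have Lr : 0 < L - r by rewrite subr_gt0.
exists (2 * L * `|z| / (L - r)) => n Bn.
have n0 : 0 <= n by apply: le_trans Bn; rewrite divr_ge0 // ltW.
rewrite ler_pdivrMr // in Bn.
have := ler_wpM2r n0 Bn; rewrite -subr_ge0 => h1.
have h2 : 0 <= (`|z| + z) * (2 * L * n).
  by rewrite mulr_ge0 ?mulr_ge0 // -lerBlDr sub0r ler_normr lexx orbT.
have h3 : 0 <= L * (z ^+ 2 + r) by rewrite mulr_ge0 // addr_ge0 // sqr_ge0.
rewrite -subr_ge0.
have -> : L * ((n + z) ^+ 2 + r) - n ^+ 2 * r =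
  (n * (L - r) * n - 2 * L * `|z| * n) + (`|z| + z) * (2 * L * n) + L * (z ^+ 2 + r).
  by ring.
by apply: addr_ge0 => //; apply: addr_ge0.
Qed.

Lemma violated_eventually L (r z : R) : 0 <= L -> L < r ->
  exists B, forall n, B <= n -> L * ((n + z) ^+ 2 + r) < n ^+ 2 * r.
Proof.
move=> L0 Lr; have r0 : 0 <= r by rewrite ltW // (le_lt_trans L0).
have Lr0 : 0 < r - L by rewrite subr_gt0.
have h3 : 0 <= L * (z ^+ 2 + r) by rewrite mulr_ge0 // addr_ge0 // sqr_ge0.
pose c := 2 * L * `|z| + L * (z ^+ 2 + r).
have c0 : 0 <= c by rewrite addr_ge0 // !mulr_ge0.
exists (c / (r - L) + 1) => n Bn.
have n1 : 1 <= n by apply: le_trans Bn; rewrite lerDr divr_ge0 // ltW.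
have n0 : 0 <= n by apply: le_trans n1.
rewrite -lerBrDr ler_pdivrMr // in Bn.
have := ler_wpM2r n0 Bn; rewrite -subr_ge0 => h1.
have h2 : 0 <= (`|z| - z) * (2 * L * n).
  by rewrite mulr_ge0 ?mulr_ge0 // subr_ge0 ler_norm.
have h4 : 0 <= L * (z ^+ 2 + r) * (n - 1) by rewrite mulr_ge0 // subr_ge0.
have h5 : 0 < (r - L) * n by rewrite mulr_gt0 // (lt_le_trans ltr01).
rewrite -subr_gt0.
have -> : n ^+ 2 * r - L * ((n + z) ^+ 2 + r) =
  (r - L) * n + (((n - 1) * (r - L) * n - c * n) + (`|z| - z) * (2 * L * n)
  + L * (z ^+ 2 + r) * (n - 1)).
  by rewrite /c; ring.
by rewrite ltr_wpDr //; apply: addr_ge0 => //; apply: addr_ge0.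
Qed.

Lemma gauss3_le Q C (A B : set T3) : A `<=` B -> (gauss3 Q C A <= gauss3 Q C B)%E.
Proof.
apply: ge0_le_integral_subset => x.
by rewrite lee_fin divr_ge0 ?expR_ge0 ?sqrtr_ge0.
Qed.

Section Limit.
Variables (Q : 'cV[R]_3) (C : nat -> 'M[R]_3) (K : R).
Hypotheses (Q0 : 0 < Q 0 0) (Qdet : 0 < Q 0 0 * Q 1 0 - Q 2 0 ^+ 2).
Hypotheses (Csym : forall N, (C N)^T = C N) (Cpos : forall N, positive_definite (C N)).
Hypothesis Cdiag : \forall N \near \oo, forall i, C N i i <= K / N.+1%:R.

Let n N := Num.sqrt (qform (invmx (C N)) Q Q).

Let K1 : R := `|K| + 1.

Let K1_gt0 : 0 < K1. Proof. by rewrite ltr_wpDl. Qed.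

Let coord_le : \forall N \near \oo, forall (v : 'cV[R]_3) i,
  v i 0 ^+ 2 <= K1 / N.+1%:R * qform (invmx (C N)) v v.
Proof.
apply: filterS Cdiag => N CN v i.
have q0 : 0 <= qform (invmx (C N)) v v.
  have [->|v0] := eqVneq v 0; first by rewrite /qform mulmx0 mxE.
  exact/ltW/positive_definite_invmx.
apply: le_trans (coord_le_qform_invmx v i (Csym N) (Cpos N)) _.
rewrite ler_wpM2r // (le_trans (CN i)) // ler_wpM2r //.
by rewrite (le_trans (ler_norm _)) // lerDl.
Qed.

(** The coordinate Q_11 is bounded by the length n times a factor tending to 0. *)
Let n_large B : \forall N \near \oo, B <= n N.
Proof.
have hB : \forall N \near \oo, K1 * B ^+ 2 / Q 0 0 ^+ 2 <= N.+1%:R.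
  near=> N; apply: (@le_trans _ _ N%:R); last by rewrite ler_nat.
  by near: N; exact: nbhs_infty_ger.
apply: filterS2 hB coord_le => N hN /(_ Q 0).
rewrite ler_pdivrMr ?exprn_gt0 // in hN.
rewrite mulrAC ler_pdivlMr ?ltr0n // => hQ.
have h : B ^+ 2 <= qform (invmx (C N)) Q Q.
  by rewrite -(ler_pM2l K1_gt0) (le_trans hN) // mulrC.
by rewrite (le_trans (ler_norm B)) // -sqrtr_sqr ler_sqrt // (le_trans (sqr_ge0 B)).
Unshelve. all: end_near. Qed.

Let unwhiten_cvg z i e : 0 < e -> \forall N \near \oo,
  `|col3 (unwhiten (C N) Q z) i 0 - Q i 0| < e.
Proof.
move=> e0; pose r := z.1.1 ^+ 2 + z.1.2 ^+ 2 + z.2 ^+ 2.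
have hr : \forall N \near \oo, K1 * r / e ^+ 2 < N.+1%:R.
  near=> N; apply: (@le_lt_trans _ _ N%:R); last by rewrite ltr_nat.
  by near: N; exact: nbhs_infty_ger.
apply: filterS2 hr coord_le => N hN hv.
rewrite ltr_pdivrMr ?exprn_gt0 // in hN.
pose v := col3 (unwhiten (C N) Q z) - Q.
have -> : col3 (unwhiten (C N) Q z) i 0 - Q i 0 = v i 0 by rewrite !mxE.
have h : v i 0 ^+ 2 < e ^+ 2.
  apply: le_lt_trans (hv v i) _; rewrite qform_unwhitenB // -/r.
  by rewrite mulrAC ltr_pdivrMr ?ltr0n // [ltRHS]mulrC.
by rewrite -ltr_sqr ?nnegrE ?normr_ge0 ?(ltW e0) // real_normK ?num_real.
Unshelve. all: end_near. Qed.

Let unwhiten_cone z : \forall N \near \oo, cone (unwhiten (C N) Q z).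
Proof.
have c i : col3 (unwhiten (C N) Q z) i 0 @[N --> \oo] --> Q i 0.
  by apply/cvgrPdist_lt => e e0; apply: filterS (unwhiten_cvg z i e0) => N; rewrite distrC.
have cd : col3 (unwhiten (C N) Q z) 0 0 * col3 (unwhiten (C N) Q z) 1 0
    - col3 (unwhiten (C N) Q z) 2 0 * col3 (unwhiten (C N) Q z) 2 0 @[N --> \oo] -->
    Q 0 0 * Q 1 0 - Q 2 0 * Q 2 0.
  by apply: cvgB; exact: cvgM.
near=> N; split.
  have : 0 < col3 (unwhiten (C N) Q z) 0 0.
    by near: N; exact: (cvgr_gt _ (c 0)).
  by rewrite mxE.
have : 0 < col3 (unwhiten (C N) Q z) 0 0 * col3 (unwhiten (C N) Q z) 1 0
    - col3 (unwhiten (C N) Q z) 2 0 * col3 (unwhiten (C N) Q z) 2 0.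
  by near: N; apply: (cvgr_gt _ cd); rewrite -expr2.
by rewrite !mxE -expr2.
Unshelve. all: end_near. Qed.

(** On the cone, which contains [unwhiten] z for all large N, the sets A_N need
    only agree with the condition on the distance; elsewhere they are arbitrary. *)
Let cvg_gauss3_near_mean L (A : nat -> set T3) : 0 <= L ->
  (forall N, measurable (A N)) ->
  (forall N x, cone x -> A N x <-> near_mean L Q (C N) x) ->
  gauss3 Q (C N) (A N) @[N --> \oo] --> (1 - expR (- L / 2))%:E.
Proof.
move=> L0 mA AE.
under eq_cvg do rewrite gauss3_unwhiten //.
apply: cvg_std_gauss3 => //.
- move=> N; rewrite -[X in measurable X]setTI.
  exact: (@measurable_unwhiten R (C N) Q measurableT _ (mA N)).
- move=> z zL; have [|B hB] := @satisfied_eventually L _ z.1.1 _ zL.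
    by rewrite addr_ge0 ?sqr_ge0.
  apply: filterS2 (n_large B) (unwhiten_cone z) => N /hB hN /AE -/(_ N) h.
  by apply/h; rewrite unwhiten_near_mean.
- move=> z zL; have [B hB] := violated_eventually z.1.1 L0 zL.
  apply: filterS2 (n_large B) (unwhiten_cone z) => N /hB hN /AE -/(_ N) h.
  by move/h; rewrite unwhiten_near_mean // -/(n N) leNgt hN.
Qed.

Lemma cvg_gauss3_region (M : nat -> nat) st p : (forall N, 0 < M N)%N ->
  anisotropy_statistics st -> 0 <= p < 1 ->
  gauss3 Q (C N) [set x | region p (M N) Q (C N) (st x)] @[N --> \oo] --> p%:E.
Proof.
move=> M0 stP /andP[p0 p1]; pose L := -2 * ln (1 - p).
have p1' : 0 < 1 - p by rewrite subr_gt0.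
have L0 : 0 <= L by rewrite /L mulNr -mulrN mulr_ge0 // oppr_ge0 ln_le0 // lerBlDr lerDl.
have pE : p = 1 - expR (- L / 2).
  rewrite (_ : - L / 2 = ln (1 - p)); last by rewrite /L; field.
  by rewrite lnK ?posrE // opprB addrC subrK.
have mN N : measurable (near_mean L Q (C N) : set T3) by exact: measurable_near_mean.
have -> : p%:E = (1 - expR (- L / 2))%:E by congr EFin.
apply: (@squeeze_cvge _ _ _ _
  (fun N => gauss3 Q (C N) (cone `&` near_mean L Q (C N))) _
  (fun N => gauss3 Q (C N) (~` cone `|` near_mean L Q (C N)))).
- apply: nearW => N; apply/andP; split; apply: gauss3_le => x.
    move=> [cx nx].
    exact: (proj2 (region_cone p Q (M0 N) (Csym N) (Cpos N) stP cx) nx).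
  move=> rx; have [cx|ncx] := pselect (cone x); last by left.
  by right; exact: (proj1 (region_cone p Q (M0 N) (Csym N) (Cpos N) stP cx) rx).
- apply: cvg_gauss3_near_mean => //.
    by move=> N; apply: measurableI => //; exact: measurable_cone.
  by move=> N x cx; split => [[]|].
- apply: cvg_gauss3_near_mean => //.
    by move=> N; apply: measurableU => //; apply: measurableC; exact: measurable_cone.
  by move=> N x cx; split => [[]|]; [|by []|right].
Unshelve. all: end_near. Qed.

End Limit.

End Asymptotics.

Theorem lemma4 (R : realType) (d : measure_display) (T : measurableType d)
  (P : probability T R)
  (* the field, its mean, covariance function and mean-square gradient *)
  (X : R * R -> {RV P >-> R}) (m : R) (c : R * R -> R)
  (dX : 'I_2 -> R * R -> {RV P >-> R})
  (* the domain and the sampling locations for each sample size N *)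
  (D : nat -> set (R * R)) (s : forall N : nat, 'I_N -> R * R)
  (* correlation lengths *)
  (xi : 'I_2 -> R)
  (Qstar : 'cV[R]_3) (C : nat -> 'M[R]_3)
  (hstat : forall N, wide_sense_stationary (D N) X m c)
  (hgauss : forall N, gaussian_field (D N) X)
  (hdiff : forall N, ms_derivative (D N) X dX)
  (hshort : short_ranged c)
  (hdecay : spectral_decay c)
  (hs : forall N k, D N (s N k))
  (* the asymptotic regime *)
  (hDmeas : forall N, measurable (D N))
  (harea : lebesgue2 (D N) @[N --> \oo] --> +oo%E)
  (hxi : forall i, 0 < xi i)
  (hlength : forall i,
     (extent i (D N) * ((xi i)^-1)%:E)%E @[N --> \oo] --> +oo%E)
  (hQstar : forall N u, D N u -> forall a, ('E_P[Xprod dX a u])%E = (Qstar a 0)%:E)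
  (hC : forall N, (0 < N)%N -> is_covariance_matrix P (Qhat dX (s N)) (C N))
  (hCpos : forall N, (0 < N)%N -> positive_definite (C N))
  (hCorder : exists K : R, \forall N \near \oo,
     forall a b, `|C N a b| <= K / N%:R)
  (* the anisotropy statistics, as functions of (Q_11, Q_22, Q_12) *)
  (st : R * R * R -> R * R) (hst : anisotropy_statistics st)
  (p : R) (hp : 0 <= p < 1) :
  gauss3 Qstar (C N) [set x | region p N Qstar (C N) (st x)] @[N --> \oo]
    --> p%:E.
Proof.
have [K [n0 _ hK]] := hCorder.
have Csym N : (0 < N)%N -> (C N)^T = C N.
  move=> N0; apply/matrixP => a b; rewrite mxE.
  by apply: EFin_inj; rewrite -!(hC N N0) covarianceC.
(* at N = 1, the averages are the products of derivatives at a single location *)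
have [Q0 Qdet] : 0 < Qstar 0 0 /\ Qstar 2 0 ^+ 2 < Qstar 0 0 * Qstar 1 0.
  have QX : (fun a => Xprod dX a (s 1%N ord0)) = Qhat dX (s 1%N).
    by apply/funext => a; apply/funext => w; rewrite /Qhat big_ord1 invr1 mul1r.
  apply: (@gradient_cone _ _ _ P dX (s 1%N ord0) _ (C 1%N)).
  - exact/hQstar/hs.
  - by rewrite QX; exact: hC.
  - exact: hCpos.
(* the covariance matrix is only constrained for N > 0 *)
rewrite -cvg_shiftS.
apply: (@cvg_gauss3_region _ Qstar (fun N => C N.+1) K _ _ _ _ _ succn) => //.
- by rewrite subr_gt0.
- by move=> N; exact: Csym.
- by move=> N; exact: hCpos.
- exists n0 => // N /= Nn0 i; apply: le_trans (ler_norm _) (hK N.+1 _ i i).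
  exact: leqW.
Qed.
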